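(* Assume that $F$ is convex and $L$-smooth in the sense that $\|\nabla F(\mathbf y;\xi)-\nabla F(\mathbf x;\xi)\|\le L\|\mathbf x-\mathbf y\|$ for all $\mathbf x,\mathbf y\in\mathbb R^p$ and all $\xi$; that $F$ is $\mu$-strongly convex with $\mu\ge 0$ (i.e. $F(\mathbf y)-F(\mathbf x)\ge\langle\nabla F(\mathbf x),\mathbf y-\mathbf x\rangle+\frac{\mu}{2}\|\mathbf x-\mathbf y\|^2$ for all $\mathbf x,\mathbf y\in\mathbb R^p$); that the variances at the optimum $\sigma_{\mathbf A^\perp,*}^2:=\mathbb E\|\mathcal P_{\mathbf A^\perp}(\nabla F(\widetilde{\mathbf x}^*;\xi))\|^2$ and $\sigma_{\mathbf A,*}^2:=\mathbb E\|\mathcal P_{\mathbf A}(\nabla F(\widetilde{\mathbf x}^*;\xi))\|^2$ are bounded; and that $\mathcal P_{\mathbf A}(\nabla F(\mathbf x))=\mathbf 0$ for all $\mathbf x\in\mathcal R(\mathbf A^\perp)$. Run DP-SGD for $T$ iterations with $\mathrm{gap}(\mathcal I_T)=E\ge 1$ and a constant learning rate $\eta_t=\eta\le\min\{\frac1{10L},\frac1{\mu+8L(E-1)}\}$. Let $\Delta^2=\mathbb E\|\mathcal P_{\mathbf A^\perp}(\mathbf x_0)-\widetilde{\mathbf x}^*\|^2$. Then the output $\hat{\mathbf y}$ satisfies $$\mathbb E[F(\hat{\mathbf y})-F(\widetilde{\mathbf x}^* )]\le O\Big(\min\Big\{\frac1T,(1-\mu\eta)^T\Big\}\frac{\Delta^2}{\eta}\Big)+O(\eta\,\sigma_{\mathbf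 A^\perp,*}^2)+O\big((E-1)L\eta^2\sigma_{\mathbf A,*}^2\big),$$ where the three terms are called the optimization error, the statistical error and the residual error. Choosing an appropriate step size $\eta$: in the convex case $(\mu=0)$, $$\mathbb E[F(\hat{\mathbf y})-F(\widetilde{\mathbf x}^* )]=O\Big(\frac{LE\Delta^2}{T}+\frac{\Delta}{\sqrt T}\,\sigma_{\mathbf A^\perp,*}+\frac{\sqrt[3]{(E-1)L\Delta^4}}{T^{2/3}}\,\sigma_{\mathbf A,*}^{2/3}\Big),$$ and in the strongly convex case $(\mu>0)$, with condition number $\kappa=L/\mu$, $$\mathbb E[F(\hat{\mathbf y})-F(\widetilde{\mathbf x}^* )]=\widetilde O\Big(LE\Delta^2\exp\Big(-\Theta\Big(\frac{T}{\kappa E}\Big)\Big)+\frac{\sigma_{\mathbf A^\perp,*}^2}{\mu T}+\frac{(E-1)L\,\sigma_{\mathbf A,*}^2}{\mu^2T^2}\Big).$$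
   Context: Problem: minimize $F(\mathbf x)=\mathbb E_{\xi\sim\mathcal D}F(\mathbf x;\xi)$ over $\mathbf x\in\mathbb R^p$ subject to $\mathbf A^\top\mathbf x=\mathbf 0$, where $\mathbf A$ is a matrix such that this system has non-trivial solutions, and $\nabla F(\mathbf x)=\mathbb E_\xi\nabla F(\mathbf x;\xi)$. $\mathcal R(\mathbf A)$ is the column space of $\mathbf A$ and $\mathcal R(\mathbf A^\perp)=\{\mathbf x:\mathbf A^\top\mathbf x=\mathbf 0\}$ its orthogonal complement; $\mathcal P_{\mathbf A}$ and $\mathcal P_{\mathbf A^\perp}$ are the orthogonal projections onto $\mathcal R(\mathbf A)$ and $\mathcal R(\mathbf A^\perp)$. $\widetilde{\mathbf x}^*=\arg\min_{\mathbf x\in\mathcal R(\mathbf A^\perp)}F(\mathbf x)$ is the constrained minimizer. Norms are Euclidean. DP-SGD (Delayed Projected SGD): the input is the function $F$, an initial point $\mathbf x_0$, step sizes $\eta_t$, and a set $\mathcal I_T\subset[T]=\{1,\dots,T\}$ of iterations at which a projection is performed. For $t=1,\dots,T$: set $\mathbf x_t=\mathbf x_{t-1}-\eta_{t-1}\nabla F(\mathbf x_{t-1};\xi_{t-1})$, where $\xi_{t-1}\sim\mathcal D$ is the random sample selected at that iteration; if $t\in\mathcal I_T$, replace $\mathbf x_t$ by $\mathcal P_{\mathbf A^\perp}(\mathbf x_t)$. The output, for constant step size $\eta$, is $\hat{\mathbf y}=\mathcal P_{\mathbf A^\perp}\big(\frac1{W_T}\sum_{j=0}^{T-1}(1-\mu\eta)^{T-j-1}\mathbf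 x_j\big)$ with $W_T=\sum_{j=0}^{T-1}(1-\mu\eta)^{T-j-1}$. $\mathrm{gap}(\mathcal I_T)$ is the largest interval between two consecutive elements of $\mathcal I_T$ when its elements are sorted. $O(\cdot)$ and $\Theta(\cdot)$ hide absolute constants; $\widetilde O(\cdot)$ additionally hides logarithmic factors.
   Formalization: The initial point x_0 is assumed feasible (A^T x_0 = 0), gap(I_T) counts 0 and T as projection times, and F(·;ξ) is assumed convex for every ξ; without each of these the stated bounds fail. *)

(* Defs.v *)
From HB Require Import structures.
From mathcomp Require Import all_boot all_order all_algebra.
From mathcomp Require Import all_classical all_reals all_analysis.

Set Implicit Arguments.
Unset Strict Implicit.
Unset Printing Implicit Defensive.

Import Order.TTheory GRing.Theory Num.Theory.
Import numFieldNormedType.Exports.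

Local Open Scope classical_set_scope.
Local Open Scope ring_scope.

Definition dotp (R : realType) (p : nat) (x y : 'cV[R]_p) : R :=
  \sum_(i < p) x i 0 * y i 0.

(* The library norm on matrices is the sup norm. *)
Definition enorm (R : realType) (p : nat) (x : 'cV[R]_p) : R :=
  Num.sqrt (dotp x x).

Definition grad (R : realType) (p : nat) (h : 'cV[R]_p -> R) (x : 'cV[R]_p) :
    'cV[R]_p :=
  \col_i 'D_(delta_mx i 0) h x.

Definition colspace (R : realType) (p m : nat) (A : 'M[R]_(p, m)) :
    set 'cV[R]_p :=
  range (mulmx A : 'cV[R]_m -> 'cV[R]_p).

Definition feasible (R : realType) (p m : nat) (A : 'M[R]_(p, m)) :
    set 'cV[R]_p :=
  [set x | A^T *m x = 0].

(* The point y of S such that x - y is orthogonal to S; for a linear subspace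
   S of R^p it exists and is unique, so the default value 0 is never used. *)
Definition orth_proj (R : realType) (p : nat) (S : set 'cV[R]_p)
    (x : 'cV[R]_p) : 'cV[R]_p :=
  xget 0 [set y | S y /\ forall z, S z -> dotp (x - y) z = 0].

Definition objective (R : realType) (p : nat) (d : measure_display)
    (Xi : measurableType d) (D : probability Xi R)
    (f : 'cV[R]_p -> Xi -> R) (x : 'cV[R]_p) : R :=
  fine 'E_D[f x].

Definition sgrad (R : realType) (p : nat) (Xi : Type)
    (f : 'cV[R]_p -> Xi -> R) (x : 'cV[R]_p) (z : Xi) : 'cV[R]_p :=
  grad (f ^~ z) x.

(* E || P_S (grad F(x; xi)) ||^2, possibly +oo. *)
Definition grad_var (R : realType) (p : nat) (d : measure_display)
    (Xi : measurableType d) (D : probability Xi R)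
    (f : 'cV[R]_p -> Xi -> R) (S : set 'cV[R]_p) (x : 'cV[R]_p) : \bar R :=
  'E_D[(fun z => enorm (orth_proj S (sgrad f x z)) ^+ 2)%R].

(* E || P_{A^perp}(x0) - xs ||^2, possibly +oo. *)
Definition init_dist (R : realType) (p m : nat) (d : measure_display)
    (Omega : measurableType d) (P : probability Omega R)
    (A : 'M[R]_(p, m)) (x0 : Omega -> 'cV[R]_p) (xs : 'cV[R]_p) : \bar R :=
  'E_P[(fun w => enorm (orth_proj (feasible A) (x0 w) - xs) ^+ 2)%R].

Definition mutually_independent (R : realType) (d : measure_display)
    (Omega : measurableType d) (P : probability Omega R) (I : finType)
    (G : I -> set (set Omega)) : Prop :=
  forall (J : {set I}) (B : I -> set Omega),
    (forall i, i \in J -> G i (B i)) ->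
    P (\bigcap_(i in [set` J]) B i) = (\prod_(i in J) P (B i))%E.

(* The sigma-algebras generated by the initial point (index None) and by the
   samples drawn at iterations 0, ..., T - 1. *)
Definition source_sigma (R : realType) (p : nat) (dX dO : measure_display)
    (Xi : measurableType dX) (Omega : measurableType dO) (T : nat)
    (x0 : Omega -> 'cV[R]_p) (xi : nat -> Omega -> Xi) (i : option 'I_T) :
    set (set Omega) :=
  match i with
  | None => g_sigma_preimage (fun (k : 'I_p) (w : Omega) => x0 w k 0)
  | Some t => preimage_set_system setT (xi t) measurable
  end.

(* Largest distance between consecutive elements of {0} U IT U {T}.  The start
   (0, a feasible point) and the end of the run count as synchronization
   times: otherwise the stretches before the first and after the last
   projection would not be controlled by the gap. *)
Definition gap (T : nat) (IT : seq nat) : nat :=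
  \max_(l <- pairmap (fun a b => (b - a)%N) 0%N (sort leq (T :: IT))) l.

Fixpoint dpsgd (R : realType) (p m : nat) (Xi : Type) (A : 'M[R]_(p, m))
    (f : 'cV[R]_p -> Xi -> R) (IT : seq nat) (eta : nat -> R)
    (x0 : 'cV[R]_p) (xi : nat -> Xi) (t : nat) {struct t} : 'cV[R]_p :=
  match t with
  | 0%N => x0
  | s.+1 =>
      let x := dpsgd A f IT eta x0 xi s in
      let x' := x - eta s *: sgrad f x (xi s) in
      if s.+1 \in IT then orth_proj (feasible A) x' else x'
  end.

Definition dpsgd_output (R : realType) (p m : nat) (Xi : Type)
    (A : 'M[R]_(p, m)) (f : 'cV[R]_p -> Xi -> R) (IT : seq nat) (mu eta : R)
    (x0 : 'cV[R]_p) (xi : nat -> Xi) (T : nat) : 'cV[R]_p :=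
  let wt (j : nat) := (1 - mu * eta) ^+ (T - j - 1) in
  orth_proj (feasible A)
    ((\sum_(j < T) wt j)^-1 *:
       \sum_(j < T) wt j *: dpsgd A f IT (fun=> eta) x0 xi j).

(* E[F(yhat) - F(xs)] for the run with constant step size eta. *)
Definition dpsgd_error (R : realType) (p m : nat) (dX dO : measure_display)
    (Xi : measurableType dX) (Omega : measurableType dO)
    (D : probability Xi R) (P : probability Omega R)
    (A : 'M[R]_(p, m)) (f : 'cV[R]_p -> Xi -> R) (IT : seq nat) (mu : R)
    (x0 : Omega -> 'cV[R]_p) (xi : nat -> Omega -> Xi) (T : nat)
    (xs : 'cV[R]_p) (eta : R) : \bar R :=
  'E_P[(fun w =>
          objective D f (dpsgd_output A f IT mu eta (x0 w) (xi ^~ w) T)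
          - objective D f xs)%R].

(* eta <= min{1 / (10 L), 1 / (mu + 8 L (E - 1))}, cleared of denominators:
   for mu = 0 and E = 1 the second entry is 1 / 0, which means +oo here but
   would be 0 with the library inverse. *)
Definition small_step (R : realType) (L mu : R) (E : nat) (eta : R) : Prop :=
  10 * L * eta <= 1 /\ (mu + 8 * L * (E%:R - 1)) * eta <= 1.

(* Logarithm hidden by the soft-O of the strongly convex rate; a is the ratio
   of the squared initial distance to a noise term.  A zero noise term makes
   the library quotient a equal to 0, but then the term it multiplies is 0. *)
Definition log_factor (R : realType) (a : R) : R := ln (2 + a).

(* Main.v *)
Require Import Defs.
From HB Require Import structures.
From mathcomp Require Import all_boot all_order all_algebra.
From mathcomp Require Import all_classical all_reals all_analysis.
From mathcomp Require Import measurable_realfun.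
From mathcomp Require Import ring lra zify.

Set Implicit Arguments.
Unset Strict Implicit.
Unset Printing Implicit Defensive.

Import Order.TTheory GRing.Theory Num.Theory.
Import numFieldNormedType.Exports.

Local Open Scope classical_set_scope.
Local Open Scope ring_scope.

(* Split an iterate as x_t = y_t + z_t with y_t its projection on the feasible
   subspace S.  Conditionally on the past, |y_t - xs|^2 contracts by 1 - mu eta
   up to -(7/5) eta (F(y_t) - F(xs)), a term in L eta |z_t|^2 and a term in
   eta^2 sigma_perp^2, because grad F(xs) has no component along S and every
   sample function is cocoercive.  As grad F(y_t) is orthogonal to z_t, |z_t|^2
   grows in mean by at most eta^2 (6 L (F(y_t) - F(xs)) + 3 sigma_A^2) per step
   and vanishes at every projection, so it is a sum over at most E - 1 steps.
   For small eta the F-terms of that sum are absorbed by the descent term.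
   Jensen's inequality for the geometric weights gives the first bound, and the
   two rates follow by optimizing eta. *)

(** * Euclidean structure and the projection onto the feasible subspace *)

(** Two obstacles shape the argument. The residual must not be amplified between projections,
    whereas a crude Lipschitz bound would multiply |z_t|^2 by a factor above 1 at each step. The
    sample gradient is therefore split as g(x) = (g(x) - g(y)) + (g(y) - g(xs)) + g(xs); in the
    residual step the first piece is bounded by a symmetric form of cocoercivity and absorbed by the
    monotone cross term -2 eta <g(x) - g(y), x - y>, so that the recursion is purely additive. The
    second obstacle is probabilistic: neither measurability nor integrability of the iterates is
    given. Measurability holds because sample gradients are Lipschitz in the point; conditioning is
    Tonelli's theorem for the product of the law of the past with [D]; finiteness of the means is
    carried along by induction on time, from the finite initial distance. Strong convexity is
    applied at x_t, where the gradient is taken; |y_t - xs| <= |x_t - xs| then turns its quadratic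
    term into a contraction for y_t. *)

Section dotp_theory.
Context {R : realType} {p : nat}.
Implicit Types x y z u v w : 'cV[R]_p.

Lemma dotpC x y : dotp x y = dotp y x.
Proof. by apply: eq_bigr => i _; rewrite mulrC. Qed.

Lemma dotpDl x y z : dotp (x + y) z = dotp x z + dotp y z.
Proof. by rewrite -big_split; apply: eq_bigr => i _; rewrite !mxE mulrDl. Qed.

Lemma dotpZl (a : R) x z : dotp (a *: x) z = a * dotp x z.
Proof. by rewrite mulr_sumr; apply: eq_bigr => i _; rewrite !mxE mulrA. Qed.

Lemma dotpNl x z : dotp (- x) z = - dotp x z.
Proof. by rewrite -scaleN1r dotpZl mulN1r. Qed.

Lemma dotpDr x y z : dotp z (x + y) = dotp z x + dotp z y.
Proof. by rewrite dotpC dotpDl !(dotpC z). Qed.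

Lemma dotpZr (a : R) x z : dotp z (a *: x) = a * dotp z x.
Proof. by rewrite dotpC dotpZl dotpC. Qed.

Lemma dotpNr x z : dotp z (- x) = - dotp z x.
Proof. by rewrite dotpC dotpNl dotpC. Qed.

Definition dotpE := (dotpDl, dotpDr, dotpZl, dotpZr, dotpNl, dotpNr).

Lemma dotp0l x : dotp 0 x = 0.
Proof. by rewrite -(scale0r 0) dotpZl mul0r. Qed.

Lemma dotp_suml (I : Type) (r : seq I) (P : pred I) (F : I -> 'cV[R]_p) x :
  dotp (\sum_(i <- r | P i) F i) x = \sum_(i <- r | P i) dotp (F i) x.
Proof.
by apply: (@big_morph _ _ (fun u => dotp u x)) => [u v|];
  [exact: dotpDl|exact: dotp0l].
Qed.

Lemma dotp_ge0 x : 0 <= dotp x x.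
Proof. by apply: sumr_ge0 => i _; rewrite -expr2 sqr_ge0. Qed.

Lemma dotp_eq0 x : dotp x x = 0 -> x = 0.
Proof.
move=> /eqP; rewrite psumr_eq0 => [/allP x0|i _]; last by rewrite -expr2
  sqr_ge0.
apply/matrixP => i j; rewrite (ord1 j) mxE.
by have := x0 i (mem_index_enum _); rewrite mulf_eq0 orbb => /eqP.
Qed.

Lemma dotp_mx x y : dotp x y = (x^T *m y) 0 0.
Proof. by rewrite mxE; apply: eq_bigr => i _; rewrite mxE. Qed.

Lemma enorm_sqr x : enorm x ^+ 2 = dotp x x.
Proof. exact/sqr_sqrtr/dotp_ge0. Qed.

Lemma enorm_le (c : R) x : 0 <= c -> (enorm x <= c) = (dotp x x <= c ^+ 2).
Proof.
by move=> c0; rewrite -enorm_sqr ler_sqr ?nnegrE ?sqrtr_ge0.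
Qed.

End dotp_theory.

Section orthogonal_projection.
Context {R : realType} {p m : nat} (A : 'M[R]_(p, m)).

Lemma feasible_orth_colspace (s x : 'cV[R]_p) :
  feasible A s -> colspace A x -> dotp s x = 0.
Proof.
move=> As [u _ <-]; rewrite dotpC dotp_mx trmx_mul -mulmxA (_ : A^T *m s = 0)//.
by rewrite mulmx0 mxE.
Qed.

(* For B of full column rank with the same column space as A, the projection
   is 1 - B (B^T B)^-1 B^T. *)
Lemma exists_feasible_proj : exists Q : 'M[R]_p,
  forall x, feasible A (Q *m x) /\ colspace A (x - Q *m x).
Proof.
have [r [B [C [C' [BA AB Bfree]]]]] : exists r (B : 'M[R]_(p, r)) C C',
    [/\ A = B *m C, B = A *m C' & row_free B^T].
  have /submxP[C AC] : (A^T <= row_base A^T)%MS by rewrite eq_row_base.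
  have /submxP[C' AC'] : (row_base A^T <= A^T)%MS by rewrite eq_row_base.
  exists (\rank A^T), (row_base A^T)^T, C^T, C'^T.
  split; first by rewrite -trmx_mul -AC trmxK.
    by rewrite {1}AC' trmx_mul trmxK.
  by rewrite trmxK row_base_free.
(* A row v with v B^T B = 0 satisfies |B v^T|^2 = 0, hence v = 0 by full column rank of B. *)
have Bu : B^T *m B \in unitmx.
  rewrite -row_free_unit -kermx_eq0; apply/eqP/row_matrixP => i; rewrite row0.
  set v := row i _.
  have vB : v *m (B^T *m B) = 0 by apply/sub_kermxP; exact: row_sub.
  have /sub_kermxP : v *m B^T = 0.
    apply: trmx_inj; rewrite trmx0; apply: dotp_eq0.
    rewrite dotp_mx trmxK trmx_mul trmxK mulmxA -(mulmxA v) vB.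
    by rewrite mul0mx mxE.
  by move: Bfree; rewrite -kermx_eq0 => /eqP ->; rewrite submx0 => /eqP.
exists (1%:M - B *m invmx (B^T *m B) *m B^T) => x; split.
  rewrite /feasible /= [A in A^T]BA trmx_mul mulmxBl mul1mx mulmxBr -!mulmxA.
  by rewrite (mulmxA B^T B) mulKVmx// subrr.
exists (C' *m (invmx (B^T *m B) *m B^T *m x)) => //.
by rewrite mulmxA -AB mulmxBl mul1mx subKr !mulmxA.
Qed.

(** A matrix used in place of [orth_proj]: linearity, and with it measurability of projected vectors
    and exchange with finite sums, becomes matrix algebra. *)
Definition feasible_proj : 'M[R]_p := sval (cid exists_feasible_proj).

Lemma proj_feasible x : feasible A (feasible_proj *m x).
Proof. by rewrite /feasible_proj; case: cid => Q /= /(_ x)[]. Qed.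

Lemma proj_colspace x : colspace A (x - feasible_proj *m x).
Proof. by rewrite /feasible_proj; case: cid => Q /= /(_ x)[]. Qed.

(** Uniqueness of the projection: the difference of two candidates lies in S and is orthogonal to
    itself. *)
Lemma orth_projE (S : set 'cV[R]_p) x y : S y ->
  (forall u v, S u -> S v -> S (u - v)) ->
  (forall z, S z -> dotp (x - y) z = 0) -> orth_proj S x = y.
Proof.
move=> Sy SB xy; rewrite /orth_proj; case: xgetP => [u _ [Su xu]|]; last first.
  by move=> /(_ y); case; split.
apply/eqP; rewrite -subr_eq0; apply/eqP/dotp_eq0.
rewrite -[X in dotp X _](subrKA x) dotpDl xy; last exact: SB.
by rewrite -opprB dotpNl xu ?oppr0 ?addr0//; exact: SB.
Qed.

Lemma feasibleB u v : feasible A u -> feasible A v -> feasible A (u - v).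
Proof. by rewrite /feasible/= mulmxBr => -> ->; rewrite subr0. Qed.

Lemma feasibleZ (a : R) u : feasible A u -> feasible A (a *: u).
Proof. by rewrite /feasible/= -scalemxAr => ->; rewrite scaler0. Qed.

Lemma colspaceB u v : colspace A u -> colspace A v -> colspace A (u - v).
Proof. by move=> [a _ <-] [b _ <-]; exists (a - b) => //; rewrite mulmxBr. Qed.

Lemma orth_proj_feasible x : orth_proj (feasible A) x = feasible_proj *m x.
Proof.
apply: orth_projE; [exact: proj_feasible|exact: feasibleB|move=> z Az].
by rewrite dotpC (feasible_orth_colspace Az)//; exact: proj_colspace.
Qed.

Lemma orth_proj_colspace x : orth_proj (colspace A) x = x - feasible_proj *m x.
Proof.
apply: orth_projE; [exact: proj_colspace|exact: colspaceB|move=> z Az].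
by rewrite subKr (feasible_orth_colspace _ Az)//; exact: proj_feasible.
Qed.

Lemma proj_id x : feasible A x -> feasible_proj *m x = x.
Proof.
move=> Ax; rewrite -orth_proj_feasible.
by apply: orth_projE => //; [exact: feasibleB|move=> z _; rewrite subrr dotp0l].
Qed.

Lemma dotp_proj x s : feasible A s -> dotp (feasible_proj *m x) s = dotp x s.
Proof.
move=> As; rewrite -[x in RHS](subrK (feasible_proj *m x)) dotpDl dotpC [dotp
  (x - _) _]dotpC.
by rewrite (feasible_orth_colspace As (proj_colspace x)) add0r dotpC.
Qed.

Lemma dotp_proj_compl x : dotp (feasible_proj *m x) (x - feasible_proj *m x) =
  0.
Proof. exact/feasible_orth_colspace/proj_colspace/proj_feasible. Qed.

Lemma dotp_pythagoras x :
  dotp x x = dotp (feasible_proj *m x) (feasible_proj *m x) +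
             dotp (x - feasible_proj *m x) (x - feasible_proj *m x).
Proof.
have := dotp_proj_compl x; rewrite !dotpE (dotpC _ x).
by move: (dotp x _) (dotp _ _) => a b; lra.
Qed.

End orthogonal_projection.

(** * Smooth convex functions *)

Section smooth_convex.
Local Open Scope convex_scope.
Context {R : realType} {p : nat}.
Implicit Types (x y : 'cV[R]_p) (h : 'cV[R]_p -> R).

Lemma derive_dotp_grad h x v :
  differentiable h x -> 'D_v h x = dotp (grad h x) v.
Proof.
move=> dh; rewrite deriveE// [in LHS](matrix_sum_delta v) linear_sum.
apply: eq_bigr => i _; rewrite big_ord1 linearZ/= mxE deriveE// mulrC.
by [].
Qed.

(** By convexity the difference quotients of h at x towards y, for steps in ]0, 1[, are at most h y
    - h x; the directional derivative is their limit from the right. *)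
Lemma convex_grad_lower h x y : convex_function [set: 'cV[R]_p] h ->
  differentiable h x -> h x + dotp (grad h x) (y - x) <= h y.
Proof.
move=> hc dh; rewrite -derive_dotp_grad// -lerBrDl.
have /cvg_dnbhs_at_right/cvgr_to_le := @diff_derivable _ _ _ _ _ (y - x) dh;
  apply.
near=> t.
have t0 : 0 < t by near: t; exact: nbhs_right_gt.
have t1 : t < 1 by near: t; exact: nbhs_right_lt.
have t01 : Itv.spec (@Itv.num_sem R) (Itv.Real `[0%Z, 1%Z]) t.
  by rewrite /= /Itv.num_sem/= num_real in_itv/= !ltW.
have := hc (Itv.mk t01) y x; rewrite !inE => /(_ I I).
rewrite -[(y : convex_lmodType _) <| _ |> x]/(t *: y + (1 - t) *: x).
rewrite [leRHS](_ : _ = t * h y + (1 - t) * h x)//.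
have -> : t *: y + (1 - t) *: x = t *: (y - x) + x.
  by rewrite scalerBr scalerBl scale1r addrA addrAC.
move=> hle; rewrite -[_ *: _]/(_ * _) mulrC ler_pdivrMr//=.
lra.
Unshelve. all: by end_near. Qed.

Lemma is_derive_line h x d (t : R) : (forall x, differentiable h x) ->
  is_derive t 1 (fun s : R => h (s *: d + x)) (dotp (grad h (t *: d + x)) d).
Proof.
move=> dh; rewrite -derive_dotp_grad//.
pose g1 := fun s : R => s^-1 *: (h (s *: d + (t *: d + x)) - h (t *: d + x)).
have E : (fun s : R => s^-1 *: (((fun s : R => h (s *: d + x)) \o shift t) (s
  *: 1)
    - (fun s : R => h (s *: d + x)) t)) = g1.
  by apply/funext => s; rewrite /g1 /= [s *: 1]mulr1 scalerDl addrA.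
have dv := @diff_derivable _ _ _ _ _ d (dh (t *: d + x)).
by split; rewrite /derivable /derive E.
Qed.

(** Cauchy-Schwarz without square roots: expand |u - a v|^2 >= 0 and divide by 2a; for a = 0 the
    hypothesis forces u = 0. *)
Lemma dotp_le_scaled (a : R) (u v : 'cV[R]_p) : 0 <= a ->
  dotp u u <= a ^+ 2 * dotp v v -> dotp u v <= a * dotp v v.
Proof.
rewrite le_eqVlt => /predU1P[<-|a0 uv].
  rewrite expr0n !mul0r => u0; rewrite (@dotp_eq0 _ _ u) ?dotp0l//.
  by apply/eqP; rewrite eq_le u0 dotp_ge0.
have := dotp_ge0 (u - a *: v); rewrite !dotpE (dotpC v u).
move: (dotp u u) (dotp u v) (dotp v v) uv => uu w vv uv H.
rewrite -(ler_pM2l (mulr_gt0 (ltr0n _ 2) a0)).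
by rewrite expr2 in uv; lra.
Qed.

Lemma lipschitz_grad_upper (L : R) h x y : 0 <= L ->
  (forall x, differentiable h x) ->
  (forall x y, enorm (grad h y - grad h x) <= L * enorm (x - y)) ->
  h y <= h x + dotp (grad h x) (y - x) + L / 2 * dotp (y - x) (y - x).
Proof.
move=> L0 dh Lh; set d := y - x; set c := dotp (grad h x) d.
set N := dotp d d.
(* The defect of the quadratic bound along the segment. Its derivative is nonpositive on [0, 1] by
   the Lipschitz condition, so the mean value theorem suffices and no integral of the gradient is
   taken. *)
pose g (s : R) := h (s *: d + x) - (s * c + L / 2 * N * s ^+ 2).
pose dg (s : R) := dotp (grad h (s *: d + x)) d - (c + L * N * s).
have gd (s : R) : is_derive s 1 g (dg s).
  apply: is_deriveB; first exact: is_derive_line.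
  by apply: is_derive_eq; rewrite /GRing.scale/=; field.
have gcont : {within `[0, 1], continuous g}.
  by apply: derivable_within_continuous => s _; have [] := gd s.
have [c0 c01 gE] := MVT_segment (@ler01 R) (fun s _ => gd s) gcont.
have: g 1 <= g 0.
  rewrite -subr_le0 gE subr0 mulr1 /dg subr_le0 -lerBlDl.
  move: c01; rewrite in_itv/= => /andP[c0_ge0 _].
  rewrite -dotpNl -dotpDl; have := Lh x (c0 *: d + x).
  rewrite enorm_le; last by rewrite mulr_ge0 ?sqrtr_ge0.
  rewrite exprMn enorm_sqr opprD addrCA subrr addr0 -scaleNr dotpZl dotpZr -/N.
  move: (_ - grad h x) => u Lu.
  have : dotp u u <= (L * c0) ^+ 2 * N by apply: le_trans Lu _; lra.
  by move=> /(dotp_le_scaled (mulr_ge0 L0 c0_ge0)); rewrite mulrAC.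
rewrite /g scale0r scale1r add0r subrK expr1n expr0n/= mul0r mul1r mulr0 mulr1.
by lra.
Qed.

(* The convex function h - <g y, .> is minimal at y; compare y with a gradient
   step of length 1/L from x. *)
Lemma cocoercive (L : R) h (g : 'cV[R]_p -> 'cV[R]_p) x y : 0 < L ->
  (forall x y, h x + dotp (g x) (y - x) <= h y) ->
  (forall x y, h y <= h x + dotp (g x) (y - x) + L / 2 * dotp (y - x) (y - x))
    ->
  dotp (g x - g y) (g x - g y) <= 2 * L * (h x - h y - dotp (g y) (x - y)).
Proof.
move=> L0 lo up; set d := g x - g y.
have := lo y (x - L^-1 *: d); have := up x (x - L^-1 *: d).
rewrite [x - _ - x]addrAC subrr add0r [x - _ - y]addrAC.
have gxd : dotp (g x) d = dotp d d + dotp (g y) d by rewrite -dotpDl /d subrK.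
rewrite [dotp (g y) (_ - _)]dotpDr !(dotpNr, dotpNl, dotpZl, dotpZr) gxd.
move: (dotp d d) (dotp (g y) d) (dotp (g y) (x - y)) (h (_ - _)) => D a b H.
move=> H1 H2.
have H3 : h y + (b - L^-1 * a) <= h x - L^-1 * (D + a) + L / 2 * (L^-1 * (L^-1
  * D)) by lra.
have e : L / 2 * (L^-1 * (L^-1 * D)) = L^-1 * D / 2 by field; lra.
rewrite e in H3.
have : L^-1 * D <= 2 * (h x - h y - b) by lra.
by rewrite ler_pdivrMl//; lra.
Qed.

End smooth_convex.

(** * Synchronization windows and the error recursion *)

Lemma gap_cover (T E t : nat) (IT : seq nat) : gap T IT = E -> (t < T)%N ->
  exists s, [/\ (s <= t)%N, (t < s + E)%N & s = 0%N \/ s \in IT].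
Proof.
move=> gE tT.
(* Follow the list to its first entry beyond t; the entry just before it is at most t, and the two
   differ by at most E. The entry T guarantees that such a crossing exists. *)
have cover a l : (a <= t)%N -> has (fun b => (t < b)%N) l ->
    (forall x, x \in pairmap (fun a b => (b - a)%N) a l -> (x <= E)%N) ->
    exists2 s, s \in a :: l & (s <= t < s + E)%N.
  elim: l a => [//|b l ih] a at_ /= + lE.
  have [tb _|bt /= hl] := ltnP t b.
    exists a; first exact: mem_head.
    rewrite at_ (leq_trans tb)// -leq_subLR lE//.
    exact: mem_head.
  have [x xl|s sl st] := ih b bt hl; first by apply: lE; rewrite inE xl orbT.
  by exists s => //; rewrite inE sl orbT.
have [|x|s] := cover 0%N (sort leq (T :: IT)) (leq0n t).
- by apply/hasP; exists T => //; rewrite mem_sort mem_head.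
- by rewrite -gE /gap => xl; rewrite (big_rem x xl)/= leq_maxl.
rewrite !inE mem_sort inE => /predU1P[->|/orP[/eqP ->|sIT]] /andP[st tE].
- by exists 0%N; split=> //; left.
- by move: st; rewrite leqNgt tT.
- by exists s; split=> //; right.
Qed.

(** * Weighted summation of the coupled recursions *)

Section descent.
Context {R : realType}.

Lemma bernoulli_ge (x : R) k : 0 <= x <= 1 -> 1 - k%:R * x <= (1 - x) ^+ k.
Proof.
move=> /andP[x0 x1]; elim: k => [|k ih]; first by rewrite mul0r subr0 expr0.
rewrite exprS -natr1; apply: (@le_trans _ _ ((1 - x) * (1 - k%:R * x))).
  have : 0 <= k%:R * x * x by rewrite !mulr_ge0.
  by lra.
by apply: ler_wpM2l => //; rewrite subr_ge0.
Qed.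

(** After exchanging the sums, X s is counted only for t = s+1, ..., s+E-1. The factor E - 1, rather
    than E, is what makes the residual error vanish when every step is projected. *)
Lemma sum_window (T E : nat) (X : nat -> R) : (forall s, 0 <= X s) ->
  \sum_(t < T) \sum_(s < T | (s < t < s + E)%N) X s
    <= E.-1%:R * \sum_(s < T) X s.
Proof.
move=> X0; rewrite (exchange_big_dep xpredT)//= mulr_sumr.
apply: ler_sum => s _; rewrite sumr_const -[X s *+ _]mulr_natl.
apply: ler_wpM2r => //; rewrite ler_nat.
rewrite cardE -(size_map (@nat_of_ord T)) -(size_iota s.+1 E.-1).
apply: uniq_leq_size; first by rewrite (map_inj_uniq (@ord_inj T)) enum_uniq.
move=> _ /mapP[t + ->]; rewrite mem_enum.
rewrite unfold_in mem_iota /= => /andP[-> tE].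
by apply: leq_trans tE _; rewrite addSn -addnS leq_add2l leqSpred.
Qed.

Lemma unrolled_recursion (q : R) (r u v : nat -> R) n : 0 <= q ->
  (forall t, (t < n)%N -> r t.+1 + u t <= q * r t + v t) ->
  r n + \sum_(j < n) q ^+ (n - j - 1) * u j <=
    q ^+ n * r 0%N + \sum_(j < n) q ^+ (n - j - 1) * v j.
Proof.
move=> q0; elim: n => [|n ih] H; first by rewrite !big_ord0 expr0 mul1r.
rewrite !big_ord_recr/= subSnn subnn expr0 !mul1r.
have shift (w : nat -> R) : \sum_(i < n) q ^+ (n.+1 - i - 1) * w i =
    q * \sum_(i < n) q ^+ (n - i - 1) * w i.
  rewrite mulr_sumr; apply: eq_bigr => i _.
  by rewrite mulrA -exprS; congr (_ ^+ _ * _); have := ltn_ord i; lia.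
rewrite !shift exprS.
have := ih (fun t tn => H t (ltnW tn)); have := H n (leqnn _).
move=> H1 /(ler_wpM2l q0); lra.
Qed.

(** Costs add up from the last synchronization s0 to t. Every s in [s0, t[ satisfies t < s + E, so
    the sum extends to a window that no longer depends on s0; this is what allows the later exchange
    of sums. *)
Lemma residual_le_window (z c : nat -> R) (T E t : nat) :
  (forall t, (t < T)%N -> z t.+1 <= z t + c t) -> (forall t, 0 <= c t) ->
  (t < T)%N ->
  (exists s, [/\ (s <= t)%N, (t < s + E)%N & z s = 0]) ->
  z t <= \sum_(s < T | (s < t < s + E)%N) c s.
Proof.
move=> zc c0 tT [s0 [s0t tE zs0]].
have zsum k : (s0 + k < T)%N -> z (s0 + k)%N <= \sum_(s0 <= s < s0 + k) c s.
  elim: k => [|k ih] kT; first by rewrite addn0 big_geq// zs0.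
  rewrite addnS big_nat_recr ?leq_addr//=.
  apply: le_trans (zc _ _) _; first by rewrite (leq_trans _ kT)// addnS.
  by rewrite lerD2r ih// (leq_trans _ kT)// addnS.
rewrite -[t in z t](subnKC s0t).
apply: le_trans (zsum _ _) _; rewrite subnKC//.
rewrite (big_nat_widen _ _ _ _ _ (ltnW tT)) big_mkcond/= (big_nat_widenl _
  0)//=.
rewrite big_mkord [leRHS]big_mkcond [leLHS]big_mkcond/=.
apply: ler_sum => s _.
case: (leqP s0 s) => [s0s|_]; last by case: ifP.
case: (ltnP s t) => [st|_//].
by rewrite (leq_trans tE)// leq_add2r.
Qed.

(** The sequences stand for the means of |y_t - xs|^2, F(y_t) - F(xs) and |z_t|^2. Substituting the
    windowed bound on z puts 13/10 * 8/7 * 6 * (e L eta) * (L eta) in front of the eta d-sum; with e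
    L eta <= 1/8 and L eta <= 1/10 this is below 2/5, so of the descent coefficient 7/5 at least 1
    survives. The constant 5 dominates 13/10 * 8/7 * 3. *)
Lemma weighted_descent (L mu eta sp sa : R) (T E : nat) (r d z : nat -> R) :
  let q := 1 - mu * eta in
  0 < L -> 0 <= mu -> mu <= L -> 0 < eta -> (1 <= E)%N ->
  small_step L mu E eta ->
  0 <= sa -> (forall t, 0 <= r t) -> (forall t, 0 <= d t) ->
  (forall t, (t < T)%N -> r t.+1 <=
    q * r t - 7 / 5 * eta * d t + 13 / 10 * eta * L * z t + 3 * eta ^+ 2 * sp)
      ->
  (forall t, (t < T)%N -> z t.+1 <= z t + eta ^+ 2 * (6 * L * d t + 3 * sa)) ->
  (forall t, (t < T)%N ->
     exists s, [/\ (s <= t)%N, (t < s + E)%N & z s = 0]) ->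
  eta * \sum_(j < T) q ^+ (T - j - 1) * d j <=
    q ^+ T * r 0%N + (3 * eta ^+ 2 * sp + 5 * (E%:R - 1) * L * eta ^+ 3 * sa)
                     * \sum_(j < T) q ^+ (T - j - 1).
Proof.
move=> q L0 mu0 muL eta0 E1 [step1 step2] sa0 r0 d0 Hr Hz Hgap.
set e : R := E%:R - 1 in step2 *.
have e0 : 0 <= e by rewrite subr_ge0 ler1n.
have eE : E.-1%:R = e by rewrite /e -[in RHS](prednK E1) -natr1 addrK.
have mueta0 : 0 <= mu * eta by rewrite mulr_ge0// ltW.
have eLeta : e * L * eta <= 1 / 8 by lra.
have Leta : mu * eta <= L * eta by rewrite ler_pM2r.
have mueta : mu * eta <= 1 / 10 by lra.
have q0 : 0 < q by rewrite /q; lra.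
pose w j := q ^+ (T - j - 1).
have w0 j : 0 < w j by rewrite exprn_gt0.
pose c t := eta ^+ 2 * (6 * L * d t + 3 * sa).
have c0 t : 0 <= c t.
  by rewrite mulr_ge0 ?sqr_ge0// addr_ge0 ?mulr_ge0 ?d0// ltW.
(* By Bernoulli the weights vary by a factor at most 8/7 in a window of E steps,
   since mu eta (E - 1) <= L eta (E - 1) <= 1/8. *)
have wz t : (t < T)%N -> w t * z t <=
    \sum_(s < T | (s < t < s + E)%N) 8 / 7 * (w s * c s).
  move=> tT; apply: (@le_trans _ _ (w t * \sum_(s < T | (s < t < s + E)%N) c
    s)).
    apply: ler_wpM2l; first exact/ltW/w0.
    by apply: residual_le_window => //; exact: Hgap.
  rewrite mulr_sumr; apply: ler_sum => s /andP[st tE].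
  rewrite [leRHS]mulrA; apply: ler_wpM2r => //.
  have -> : w s = w t * q ^+ (t - s).
    by rewrite -exprD; congr (_ ^+ _); clear -st tT; lia.
  have : 7 / 8 <= q ^+ (t - s).
    apply: le_trans (bernoulli_ge _ _); last by rewrite mueta0/=; lra.
    have : (t - s)%:R * (mu * eta) <= e * (L * eta).
      apply: ler_pM => //; rewrite -eE ler_nat; clear -st tE; lia.
    by lra.
  have := w0 t; move: (w t) (q ^+ _) => x y x0 y0.
  have : x * (7 / 8) <= x * y by rewrite ler_pM2l.
  by lra.
have sz : \sum_(t < T) w t * z t <= 8 / 7 * e * \sum_(s < T) w s * c s.
  apply: (@le_trans _ _ (\sum_(t < T) \sum_(s < T | (s < t < s + E)%N)
      8 / 7 * (w s * c s))).
    by apply: ler_sum => t _; exact: wz.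
  have X0 s : 0 <= 8 / 7 * (w s * c s).
    by apply: mulr_ge0; [lra|apply: mulr_ge0 => //; exact/ltW/w0].
  by have := @sum_window T E _ X0; rewrite eE -mulr_sumr; lra.
have := @unrolled_recursion q r (fun t => 7 / 5 * eta * d t)
  (fun t => 13 / 10 * eta * L * z t + 3 * eta ^+ 2 * sp) T (ltW q0).
have -> : \sum_(j < T) q ^+ (T - j - 1) * (7 / 5 * eta * d j) =
    7 / 5 * eta * \sum_(j < T) w j * d j.
  by rewrite mulr_sumr; apply: eq_bigr => j _; rewrite /w; ring.
have -> : \sum_(j < T) q ^+ (T - j - 1) *
    (13 / 10 * eta * L * z j + 3 * eta ^+ 2 * sp) =
    13 / 10 * eta * L * \sum_(j < T) w j * z j +
    3 * eta ^+ 2 * sp * \sum_(j < T) w j.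
  by rewrite !mulr_sumr -big_split; apply: eq_bigr => j _; rewrite /w /=; ring.
have scE : \sum_(s < T) w s * c s = 6 * L * eta ^+ 2 * \sum_(j < T) w j * d j +
    3 * sa * eta ^+ 2 * \sum_(j < T) w j.
  by rewrite !mulr_sumr -big_split; apply: eq_bigr => j _; rewrite /c /=; ring.
rewrite scE in sz.
rewrite -/w.
have : 0 <= \sum_(j < T) w j * d j by apply: sumr_ge0 => j _; rewrite
  mulr_ge0// ltW.
have : 0 <= \sum_(j < T) w j by apply: sumr_ge0 => j _; rewrite ltW.
have := r0 T; move: sz (r T).
move: (\sum_(j < T) w j * d j) (\sum_(j < T) w j) (\sum_(j < T) w j * z j).
move=> WD W WZ sz rT rT0 W0 WD0 H.
have {}H : rT + 7 / 5 * eta * WD <=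
  q ^+ T * r 0%N + (13 / 10 * eta * L * WZ + 3 * eta ^+ 2 * sp * W).
  by apply: H => t tT; have := Hr t tT; lra.
have : eta * L * WZ <=
    eta * L * (8 / 7 * e * (6 * L * eta ^+ 2 * WD + 3 * sa * eta ^+ 2 * W)).
  by apply: ler_wpM2l => //; rewrite mulr_ge0 ?ltW.
have : e * L * eta * (L * eta) * (eta * WD) <= 1 / 8 * (1 / 10) * (eta * WD).
  apply: ler_wpM2r; first by rewrite mulr_ge0// ltW.
  have Leta0 : 0 <= L * eta by rewrite mulr_ge0 // ltW.
  apply: ler_pM => //; last by lra.
  by rewrite -mulrA mulr_ge0.
have : 0 <= e * L * eta ^+ 3 * sa * W by rewrite !mulr_ge0 ?exprn_ge0// ltW.
have : 0 <= eta * WD by rewrite mulr_ge0// ltW.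
lra.
Qed.

End descent.

(** * Choice of the step size *)

Section step_sizes.
Context {R : realType}.

(** W >= 1 because the last weight is q^0, and W >= T q^T because each weight is at least q^T; the
    two facts give the two entries of the minimum. *)
Lemma weight_sum_bounds (q : R) T : 0 < q <= 1 -> (1 <= T)%N ->
  let W := \sum_(j < T) q ^+ (T - j - 1) in
  0 < W /\ q ^+ T / W <= Num.min T%:R^-1 (q ^+ T).
Proof.
move=> /andP[q0 q1] T1 W.
have w0 k : 0 <= q ^+ k by rewrite exprn_ge0// ltW.
have W1 : 1 <= W.
  rewrite /W; case: T T1 @W => // T _ W; rewrite big_ord_recr/= subSnn subnn
    expr0.
  by rewrite lerDr sumr_ge0.
have W0 : 0 < W by apply: lt_le_trans W1.
split=> //; rewrite le_min; apply/andP; split; last first.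
  by rewrite ler_pdivrMr// ler_peMr.
rewrite ler_pdivrMr// mulrC ler_pdivlMr ?ltr0n// mulr_natr.
rewrite -[T in _ *+ T]card_ord -sumr_const; apply: ler_sum => j _.
by apply: ler_wiXn2l; rewrite ?(ltW q0)//; lia.
Qed.

Lemma powR_cube (x r : R) : (x `^ r) ^+ 3 = x `^ (r * 3).
Proof. by rewrite -powR_mulrn ?powR_ge0// powRrM. Qed.

(** The inverse step is the sum of the three inverse steps suited to the stability constraint and to
    each noise term. Using the sum instead of their maximum avoids a case distinction: the
    optimization term is linear in the inverse step, and each noise term only needs eta below its
    own threshold. *)
Lemma convex_step_size (T E : nat) (L D s a : R) :
  0 < L -> 0 < D -> 0 <= s -> 0 <= a -> (1 <= T)%N -> (1 <= E)%N ->
  exists eta : R, [/\ 0 < eta, small_step L 0 E eta &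
    T%:R^-1 * (D ^+ 2 / eta) + eta * s ^+ 2
      + (E%:R - 1) * L * eta ^+ 2 * a ^+ 2 <=
    10 * (L * E%:R * D ^+ 2 / T%:R + D / Num.sqrt T%:R * s
      + ((E%:R - 1) * L * D ^+ 4) `^ (1 / 3) / T%:R `^ (2 / 3)
        * a `^ (2 / 3))].
Proof.
move=> L0 D0 s0 a0 T1 E1.
set B := _ * a `^ _; set e : R := E%:R - 1.
have e0 : 0 <= e by rewrite subr_ge0 ler1n.
have eE : E%:R = e + 1 by rewrite subrK.
set t : R := T%:R; have t0 : 0 < t by rewrite ltr0n.
have B0 : 0 <= B by rewrite !mulr_ge0 ?invr_ge0 ?powR_ge0.
(* Cubing removes the fractional powers, after which all identities are rational. *)
have BE : B ^+ 3 = e * L * D ^+ 4 * a ^+ 2 / t ^+ 2.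
  rewrite /B !exprMn exprVn !powR_cube !divfK// powRr1; last first.
    by rewrite !mulr_ge0 ?exprn_ge0// ltW.
  by rewrite -!(powR_mulrn 2)// ?ltW// mulrAC.
pose u := Num.sqrt t; have u0 : 0 < u by rewrite sqrtr_gt0.
have tE : t = u ^+ 2 by rewrite sqr_sqrtr// ltW.
(* The step 1/al equates D^2 / (eta T) with eta s^2; the step 1/b makes D^2 / (eta T) equal to B. *)
pose al := u * s / D; pose b := B * t / D ^+ 2.
have al0 : 0 <= al by rewrite /al !mulr_ge0 ?invr_ge0// ltW.
have b0 : 0 <= b by apply: divr_ge0; [exact: mulr_ge0 B0 (ltW t0)|exact:
  sqr_ge0].
pose M := 10 * L * E%:R + al + b.
have LE : 0 < L * E%:R by rewrite mulr_gt0 ?ltr0n.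
have M0 : 0 < M by rewrite /M; lra.
have Mi : 0 < M^-1 by rewrite invr_gt0.
exists M^-1; split => //.
  split; rewrite ler_pdivrMr// mul1r /M eE; have := mulr_ge0 e0 (ltW L0); lra.
rewrite -/t -/u invrK.
have -> : t^-1 * (D ^+ 2 * M) =
    10 * (L * E%:R * D ^+ 2 / t) + D / u * s + B.
  by rewrite /M /al /b tE; field; rewrite !gt_eqF.
have alM : al / M <= 1 by rewrite ler_pdivrMr// mul1r /M; lra.
have bM : b / M <= 1 by rewrite ler_pdivrMr// mul1r /M; lra.
have -> : M^-1 * s ^+ 2 = al / M * (D / u * s).
  by rewrite /al; field; rewrite !gt_eqF.
have Dus : 0 <= D / u * s by rewrite !mulr_ge0 ?invr_ge0// ltW.
have -> : e * L * M^-1 ^+ 2 * a ^+ 2 = (b / M) ^+ 2 * B.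
  have -> : e * L * M^-1 ^+ 2 * a ^+ 2 =
      M^-1 ^+ 2 * (t ^+ 2 / D ^+ 4) * B ^+ 3.
    by rewrite BE; field; rewrite !gt_eqF.
  by rewrite /b; field; rewrite !gt_eqF.
have : al / M * (D / u * s) <= D / u * s by rewrite ler_piMl.
have : (b / M) ^+ 2 * B <= B.
  by rewrite ler_piMl// expr_le1// mulr_ge0// ltW.
have : 0 <= L * E%:R * D ^+ 2 / t by rewrite !mulr_ge0 ?invr_ge0 ?exprn_ge0//
  ltW.
lra.
Qed.

(** The inequality ln 2 >= 1/2 follows from exp(-ln 2) >= 1 - ln 2. *)
Lemma log_factor_ge (a : R) : 0 <= a -> 1 / 2 <= log_factor a.
Proof.
move=> a0; apply: (@le_trans _ _ (ln 2)).
  have := expR_ge1Dx (- ln 2 : R); rewrite expRN lnK ?posrE//; lra.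
by rewrite /log_factor ler_ln ?posrE; lra.
Qed.

(** With mu eta T equal to the logarithm of 2 + c, the exponential is 1 / (2 + c), and c is chosen
    so that D2 x / c is the noise level N. *)
Lemma log_step_error (D2 x N c : R) : 0 <= D2 -> 0 < x -> 0 < N -> 0 <= c ->
  c = x * D2 / N ->
  expR (- log_factor c) * (D2 * x / log_factor c) <= N / log_factor c.
Proof.
move=> D0 x0 N0 c0 cE; have := log_factor_ge c0; rewrite /log_factor => l0.
have c2 : 0 < 2 + c by lra.
rewrite expRN lnK ?posrE// mulrA; apply: ler_wpM2r; first by rewrite invr_ge0;
  lra.
rewrite ler_pdivrMl//.
have : c * N = D2 * x by rewrite cE divfK ?gt_eqF// mulrC.
nra.
Qed.

(** The step is the smallest of the stability step [em] and the logarithmic steps [l1 / x],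
    [l2 / x]. Being below a logarithmic step bounds the corresponding noise term; whichever
    candidate is attained bounds the optimization term by X, Y or Z respectively. *)
Lemma strongly_convex_step_size (T E : nat) (L mu D s a : R) :
  0 < mu -> mu <= L -> 0 <= s -> 0 <= a -> (1 <= T)%N -> (1 <= E)%N ->
  exists eta : R, [/\ 0 < eta, small_step L mu E eta &
    (1 - mu * eta) ^+ T * (D ^+ 2 / eta) + eta * s ^+ 2
      + (E%:R - 1) * L * eta ^+ 2 * a ^+ 2 <=
    10 * (L * E%:R * D ^+ 2 * expR (- (1 / 10 * (T%:R / (L / mu * E%:R))))
      + log_factor ((mu * T%:R * D) ^+ 2 / s ^+ 2) * (s ^+ 2 / (mu * T%:R))
      + log_factor ((mu * T%:R) ^+ 3 * D ^+ 2 / ((E%:R - 1) * L * a ^+ 2)) ^+ 2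
        * ((E%:R - 1) * L * a ^+ 2 / (mu ^+ 2 * T%:R ^+ 2)))].
Proof.
move=> mu0 muL s0 a0 T1 E1.
have L0 : 0 < L by apply: lt_le_trans muL.
set e : R := E%:R - 1; set t : R := T%:R.
have t0 : 0 < t by rewrite ltr0n.
have e0 : 0 <= e by rewrite subr_ge0 ler1n.
have eE : E%:R = e + 1 by rewrite subrK.
set A := e * L * a ^+ 2.
have A0 : 0 <= A by rewrite !mulr_ge0 ?exprn_ge0// ltW.
set x := mu * t; have x0 : 0 < x by rewrite mulr_gt0.
set c1 := (x * D) ^+ 2 / s ^+ 2; set c2 := x ^+ 3 * D ^+ 2 / A.
have c10 : 0 <= c1 by apply: divr_ge0; exact: sqr_ge0.
have c20 : 0 <= c2.
  apply: divr_ge0 => //; apply: mulr_ge0; last exact: sqr_ge0.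
  exact/exprn_ge0/ltW.
have := log_factor_ge c10; have := log_factor_ge c20.
set l1 := log_factor c1; set l2 := log_factor c2 => l2_ge l1_ge.
rewrite -exprMn -/x.
have LE : 0 < L * E%:R by rewrite mulr_gt0 ?ltr0n.
pose em := (10 * (L * E%:R))^-1.
have em0 : 0 < em by rewrite invr_gt0 mulr_gt0.
pose X := L * E%:R * D ^+ 2 * expR (- (1 / 10 * (t / (L / mu * E%:R)))).
have X0 : 0 <= X.
  apply: mulr_ge0; last exact: expR_ge0.
  by apply: mulr_ge0; [exact: ltW|exact: sqr_ge0].
pose Y := l1 * (s ^+ 2 / x); pose Z := l2 ^+ 2 * (A / x ^+ 2).
have Y0 : 0 <= Y.
  by apply: mulr_ge0; [lra|apply: divr_ge0; [exact: sqr_ge0|exact: ltW]].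
have Z0 : 0 <= Z.
  by apply: mulr_ge0; [exact: sqr_ge0|apply: divr_ge0 => //; exact: sqr_ge0].
(* A logarithmic step is imposed only when its noise is nonzero: for zero noise the quotient inside
   the logarithm degenerates to 0, and the resulting step would not control the optimization term.
   The factors 4 and 8 come from 1 <= 4 l1^2 and 1 <= 8 l2^3, as both logarithms are at least
   1/2. *)
suff [eta [eta0 etam eta1 eta2 opt]] : exists eta, [/\ 0 < eta, eta <= em,
    s != 0 -> eta <= l1 / x, A != 0 -> eta <= l2 / x &
    expR (- (mu * eta * t)) * (D ^+ 2 / eta) <= 10 * X + 4 * Y + 8 * Z].
  have step : 10 * (L * E%:R) * eta <= 1.
    by move: etam; rewrite /em -[_^-1]mul1r ler_pdivlMr ?(mulr_gt0 _ LE)//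
      mulrC.
  have eLeta : 0 <= e * L * eta by rewrite !mulr_ge0// ltW.
  have mueta : mu * eta <= L * eta by rewrite ler_pM2r.
  rewrite eE in step.
  have Leta0 : 0 < L * eta by rewrite mulr_gt0.
  exists eta; split => //; first by split; rewrite ?eE; lra.
  have q0 : 0 <= 1 - mu * eta by lra.
  have opt' : (1 - mu * eta) ^+ T * (D ^+ 2 / eta) <= 10 * X + 4 * Y + 8 * Z.
    apply: le_trans opt; apply: ler_wpM2r; first by rewrite mulr_ge0 ?sqr_ge0//
      invr_ge0 ltW.
    rewrite -(mulNr _ t) expRM_natr; apply: lerXn2r; rewrite ?nnegrE
      ?expR_ge0//.
    by have := expR_ge1Dx (- (mu * eta)); lra.
  have H1 : eta * s ^+ 2 <= Y.
    have [->|/eta1 h] := eqVneq s 0; first by rewrite expr0n mulr0.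
    by apply: le_trans (ler_wpM2r (sqr_ge0 s) h) _; rewrite /Y; lra.
  have H2 : e * L * eta ^+ 2 * a ^+ 2 <= Z.
    have -> : e * L * eta ^+ 2 * a ^+ 2 = eta ^+ 2 * A by rewrite /A; ring.
    have [A00|/eta2 h] := eqVneq A 0; first by rewrite A00 mulr0.
    have : eta ^+ 2 <= (l2 / x) ^+ 2.
      by apply: lerXn2r => //; rewrite nnegrE; [|apply: le_trans h]; exact: ltW.
    move=> /(ler_wpM2r A0) /le_trans; apply.
    by rewrite /Z expr_div_n; lra.
  by rewrite -/X -/Y -/Z; lra.
have em_opt : expR (- (mu * em * t)) * (D ^+ 2 / em) <= 10 * X + 4 * Y + 8 * Z.
  have -> : expR (- (mu * em * t)) * (D ^+ 2 / em) = 10 * X.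
    rewrite /em invrK /X -/em.
    have -> : mu * em * t = 1 / 10 * (t / (L / mu * E%:R)).
      by rewrite /em; field; rewrite !gt_eqF// ltr0n.
    by ring.
  by lra.
have l1_opt : s != 0 ->
    expR (- (mu * (l1 / x) * t)) * (D ^+ 2 / (l1 / x)) <= 10 * X + 4 * Y + 8 *
      Z.
  move=> sN; have s20 : 0 < s ^+ 2 by rewrite exprn_gt0// lt_def sN.
  have -> : mu * (l1 / x) * t = l1 by rewrite /x; field; rewrite !gt_eqF.
  have -> : D ^+ 2 / (l1 / x) = D ^+ 2 * x / l1.
    by field; rewrite !gt_eqF//; lra.
  apply: le_trans (@log_step_error _ _ (s ^+ 2 / x) _ _ _ _ _ _) _ => //.
  - exact: sqr_ge0.
  - exact: divr_gt0.
  - by rewrite /c1; field; rewrite sN gt_eqF.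
  have : s ^+ 2 / x / l1 <= 4 * Y.
    rewrite ler_pdivrMr; last lra.
    rewrite /Y; have : 0 < s ^+ 2 / x by rewrite divr_gt0.
    have : 1 <= 4 * (l1 * l1) by nra.
    move: (s ^+ 2 / x) => w; nra.
  by lra.
have l2_opt : A != 0 ->
    expR (- (mu * (l2 / x) * t)) * (D ^+ 2 / (l2 / x)) <= 10 * X + 4 * Y + 8 *
      Z.
  move=> AN; have A_gt0 : 0 < A by rewrite lt_def AN.
  have -> : mu * (l2 / x) * t = l2 by rewrite /x; field; rewrite !gt_eqF.
  have -> : D ^+ 2 / (l2 / x) = D ^+ 2 * x / l2.
    by field; rewrite !gt_eqF//; lra.
  apply: le_trans (@log_step_error _ _ (A / x ^+ 2) _ _ _ _ _ _) _ => //.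
  - exact: sqr_ge0.
  - by rewrite divr_gt0 ?exprn_gt0.
  - by rewrite /c2; field; rewrite AN gt_eqF.
  have : A / x ^+ 2 / l2 <= 8 * Z.
    rewrite ler_pdivrMr; last lra.
    rewrite /Z; have : 0 < A / x ^+ 2 by rewrite divr_gt0 ?exprn_gt0.
    have : 1 <= 8 * (l2 ^+ 2 * l2).
      have : 1 / 4 <= l2 ^+ 2 by rewrite expr2; nra.
      move: (l2 ^+ 2) => w; nra.
    move: (A / x ^+ 2) (l2 ^+ 2) => w v; nra.
  by lra.
have l1x0 : 0 < l1 / x by apply: divr_gt0 => //; lra.
have l2x0 : 0 < l2 / x by apply: divr_gt0 => //; lra.
have [sz|sN] := eqVneq s 0; have [Az|AN] := eqVneq A 0.
- by exists em; split => //; rewrite ?sz ?Az eqxx.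
- have [h|h] := leP em (l2 / x).
    by exists em; split => //; rewrite sz eqxx.
  by exists (l2 / x); split; rewrite ?sz ?eqxx ?(ltW h)//; exact: l2_opt.
- have [h|h] := leP em (l1 / x).
    by exists em; split => //; rewrite Az eqxx.
  by exists (l1 / x); split; rewrite ?Az ?eqxx ?(ltW h)//; exact: l1_opt.
- have [h|h] := leP em (l1 / x); have [h'|h'] := leP em (l2 / x).
  + by exists em; split.
  + by exists (l2 / x); split; rewrite ?(ltW h')//; [move=> _; lra|exact:
    l2_opt].
  + by exists (l1 / x); split; rewrite ?(ltW h)//; [move=> _; lra|exact:
    l1_opt].
  + have [k|k] := leP (l1 / x) (l2 / x).
      by exists (l1 / x); split; rewrite ?(ltW h)//; exact: l1_opt.
    by exists (l2 / x); split; rewrite ?(ltW h') ?(ltW k)//; exact: l2_opt.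
Qed.

End step_sizes.

(** * Measurability *)

Section measurability_tools.
Context {R : realType} d (W : measurableType d).

(** The last two hypotheses say that h is the pointwise supremum of the k i, so that {h > a} is the
    countable union of the sets {k i > a}. *)
Lemma measurable_fun_countable_sup (I : countType) (h : W -> R)
    (k : I -> W -> R) :
  (forall i, measurable_fun setT (k i)) -> (forall i w, k i w <= h w) ->
  (forall w e, 0 < e -> exists i, h w < k i w + e) -> measurable_fun setT h.
Proof.
move=> mk kh hk; apply: (measurability _ (RGenOInfty.measurableE R)).
move=> _ [_ [a ->] <-]; rewrite setTI.
have -> : h @^-1` `]a, +oo[%classic = \bigcup_i (k i @^-1` `]a, +oo[%classic).
  apply/seteqP; split => w /=; rewrite in_itv/= andbT => aw.
    move: aw; rewrite -subr_gt0 => /(hk w)[i hi].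
    by exists i => //=; rewrite in_itv/= andbT; lra.
  case: aw => i _ /=; rewrite in_itv/= andbT => /lt_le_trans; exact.
apply: countable_bigcupT_measurable; first exact: countableP.
move=> i; rewrite -[X in measurable X]setTI.
by apply: mk => //; exact: measurable_itv.
Qed.

Context {p : nat}.

Lemma rat_vector_dense (x : 'cV[R]_p) (e : R) : 0 < e ->
  exists q : 'cV[rat]_p, enorm (x - map_mx ratr q) < e.
Proof.
(* Coordinates within c give a squared distance at most p c^2 < (p + 1)^2 c^2 = e^2; p + 1 gives
   strictness and covers p = 0. *)
move=> e0; pose c := e / p.+1%:R.
have c0 : 0 < c by rewrite divr_gt0 ?ltr0n.
have /choice[q qx] : forall i, exists q : rat, `|x i 0 - ratr q| <= c.
  move=> i; have /rat_in_itvoo[q] : x i 0 - c < x i 0 + c by lra.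
  rewrite in_itv/= => /andP[q1 q2]; exists q.
  by rewrite ler_norml; apply/andP; split; lra.
exists (\col_i q i); rewrite -(ltr_pXn2r (ltn0Sn 1)) ?nnegrE ?sqrtr_ge0//; last
  exact: ltW.
rewrite enorm_sqr; apply: (@le_lt_trans _ _ (p%:R * c ^+ 2)).
  rewrite -[p in p%:R]card_ord -sum1_card natr_sum mulr_suml.
  apply: ler_sum => i _; rewrite mul1r !mxE -expr2 -real_normK ?num_real//.
  by apply: lerXn2r; rewrite ?nnegrE// ltW.
have -> : e ^+ 2 = p.+1%:R ^+ 2 * c ^+ 2.
  by rewrite -exprMn mulrC /c divfK// pnatr_eq0.
rewrite ltr_pM2r ?exprn_gt0// -natrX ltr_nat -mulnn; lia.
Qed.

Lemma measurable_fun_sum (I : Type) (r : seq I) (F : I -> W -> R) :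
  (forall i, measurable_fun setT (F i)) ->
  measurable_fun setT (fun w => \sum_(i <- r) F i w).
Proof.
move=> mF; elim: r => [|i r ih].
  by under eq_fun do rewrite big_nil; exact: measurable_cst.
by under eq_fun do rewrite big_cons; exact: measurable_funD.
Qed.

Definition measurable_vec (u : W -> 'cV[R]_p) :=
  forall i, measurable_fun setT (fun w => u w i 0).

Lemma measurable_vec_cst (x : 'cV[R]_p) : measurable_vec (cst x).
Proof. by move=> i; exact: measurable_cst. Qed.

Lemma measurable_vecD (u v : W -> 'cV[R]_p) :
  measurable_vec u -> measurable_vec v -> measurable_vec (fun w => u w + v w).
Proof.
by move=> mu mv i; under eq_fun do rewrite mxE; exact: measurable_funD.
Qed.

Lemma measurable_vecZ (a : R) (u : W -> 'cV[R]_p) :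
  measurable_vec u -> measurable_vec (fun w => a *: u w).
Proof.
by move=> mu i; under eq_fun do rewrite mxE; exact: measurable_funM.
Qed.

Lemma measurable_vecB (u v : W -> 'cV[R]_p) :
  measurable_vec u -> measurable_vec v -> measurable_vec (fun w => u w - v w).
Proof.
move=> mu mv; apply: measurable_vecD => // i.
by under eq_fun do rewrite mxE; exact: measurable_funN.
Qed.

Lemma measurable_vec_sum (I : Type) (r : seq I) (F : I -> W -> 'cV[R]_p) :
  (forall i, measurable_vec (F i)) ->
  measurable_vec (fun w => \sum_(i <- r) F i w).
Proof.
move=> mF i; under eq_fun do rewrite summxE.
by apply: measurable_fun_sum => j; exact: mF.
Qed.

Lemma measurable_vec_mulmx (M : 'M[R]_p) (u : W -> 'cV[R]_p) :
  measurable_vec u -> measurable_vec (fun w => M *m u w).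
Proof.
move=> mu i; under eq_fun do rewrite mxE.
by apply: measurable_fun_sum => j; apply: measurable_funM.
Qed.

Lemma measurable_dotp (u v : W -> 'cV[R]_p) :
  measurable_vec u -> measurable_vec v ->
  measurable_fun setT (fun w => dotp (u w) (v w)).
Proof.
by move=> mu mv; apply: measurable_fun_sum => i; exact: measurable_funM.
Qed.

Lemma measurable_enorm (u : W -> 'cV[R]_p) :
  measurable_vec u -> measurable_fun setT (fun w => enorm (u w)).
Proof.
move=> mu; apply: (@measurableT_comp _ _ _ _ _ _ (@Num.sqrt R)).
  by apply: continuous_measurable_fun => x; exact: sqrt_continuous.
exact: measurable_dotp.
Qed.

(* A Caratheodory-type result: g is the supremum over rational q of the
   functions g q - L |. - q|. *)
Lemma measurable_fun_lipschitz dX (Xi : measurableType dX)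
    (g : 'cV[R]_p -> Xi -> R) (L : R) (u : W -> 'cV[R]_p) (v : W -> Xi) :
  0 < L -> (forall x, measurable_fun setT (g x)) ->
  (forall z x y, `|g x z - g y z| <= L * enorm (x - y)) ->
  measurable_vec u -> measurable_fun setT v ->
  measurable_fun setT (fun w => g (u w) (v w)).
Proof.
move=> L0 mg gL mu mv.
apply: (@measurable_fun_countable_sup 'cV[rat]_p _ (fun q w =>
  g (map_mx ratr q) (v w) - L * enorm (u w - map_mx ratr q))).
- move=> q; apply: measurable_funB; first exact: measurableT_comp.
  apply: measurable_funM => //; apply: measurable_enorm.
  by apply: measurable_vecB => //; exact: measurable_vec_cst.
- move=> q w; have := gL (v w) (u w) (map_mx ratr q).
  by rewrite ler_norml => /andP[]; lra.
- move=> w e e0.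
  have [|q uq] := @rat_vector_dense (u w) (e / (2 * L)); first by rewrite
    divr_gt0 ?mulr_gt0.
  exists q; have := gL (v w) (u w) (map_mx ratr q).
  rewrite ler_norml => /andP[_].
  by move: uq; rewrite ltr_pdivlMr ?mulr_gt0//; lra.
Qed.

(** h is the supremum of its tangents at rational points: by the quadratic upper bound, the tangent
    at q falls short at u by at most L/2 |u - q|^2. *)
Lemma measurable_fun_smooth_convex (h : 'cV[R]_p -> R)
    (g : 'cV[R]_p -> 'cV[R]_p) (L : R) (u : W -> 'cV[R]_p) :
  0 < L ->
  (forall x y, h x + dotp (g x) (y - x) <= h y) ->
  (forall x y, h y <= h x + dotp (g x) (y - x) + L / 2 * dotp (y - x) (y - x))
    ->
  measurable_vec u -> measurable_fun setT (h \o u).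
Proof.
move=> L0 lo up mu.
apply: (@measurable_fun_countable_sup 'cV[rat]_p _ (fun q w =>
  h (map_mx ratr q) + dotp (g (map_mx ratr q)) (u w - map_mx ratr q))).
- move=> q; apply: measurable_funD => //; apply: measurable_dotp.
    exact: measurable_vec_cst.
  by apply: measurable_vecB => //; exact: measurable_vec_cst.
- by move=> q w; exact: lo.
- move=> w e e0.
  have [|q uq] := @rat_vector_dense (u w) (Num.sqrt (e / L)).
    by rewrite sqrtr_gt0 divr_gt0.
  exists q; have := up (map_mx ratr q) (u w).
  have : dotp (u w - map_mx ratr q) (u w - map_mx ratr q) < e / L.
    have eL : 0 <= e / L by rewrite divr_ge0 ?ltW.
    rewrite -enorm_sqr -[ltRHS]sqr_sqrtr//.
    by rewrite ltr_pXn2r ?nnegrE ?sqrtr_ge0.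
  rewrite ltr_pdivlMr//= => ? ?; lra.
Qed.

End measurability_tools.

(** * Integrating out the next sample *)

Section freezing.
Context {R : realType} {p : nat} {dX dO : measure_display}
  {Xi : measurableType dX} {Omega : measurableType dO}
  (P : probability Omega R) {T : nat}
  (x0 : Omega -> 'cV[R]_p) (xi : nat -> {RV P >-> Xi}) (t : 'I_T).

Let src := source_sigma (T := T) x0 (fun s => xi s : Omega -> Xi).

Hypothesis mx0 : measurable_vec x0.
Hypothesis indep : mutually_independent P src.

Lemma source_sigma_algebra i : sigma_algebra setT (src i).
Proof.
case: i => [s|]; last exact: smallest_sigma_algebra.
by apply: sigma_algebra_preimage; exact: sigma_algebra_measurable.
Qed.

Lemma source_sigma_measurable i B : src i B -> measurable B.
Proof.
case: i => [s [C mC <-]|]; first exact: measurable_funP.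
apply: smallest_sub; first exact: sigma_algebra_measurable.
apply: (big_ind (fun A => A `<=` measurable)) => [//|A C Am Cm|k _ _ [D mD <-]].
  by rewrite subUset.
exact: mx0.
Qed.

Lemma source_sigmaI i B C : src i B -> src i C -> src i (B `&` C).
Proof.
rewrite -(measurable_g_measurableTypeE (source_sigma_algebra i)).
exact: measurableI.
Qed.

Definition past_index : {set option 'I_T} :=
  [set i : option 'I_T | if i is Some s then (s < t)%N else true]%SET.

(* A pi-system generating the sigma-algebra of the initial point and of the
   samples drawn before time t. *)
Definition past_events : set (set Omega) :=
  [set C | exists2 B : option 'I_T -> set Omega,
    (forall i, i \in past_index -> src i (B i)) &
    C = \bigcap_(i in [set` past_index]) B i].

(** [Omega] with the smaller sigma-algebra of the past, so that being determined by the past is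
    ordinary measurability on another type. *)
Definition past : Type := g_sigma_algebraType past_events.
HB.instance Definition _ := Measurable.copy past
  (g_sigma_algebraType past_events).

Lemma past_eventsT : past_events setT.
Proof.
exists (fun=> setT) => [i _|]; last by rewrite bigcapT.
have [s0 sC _] := source_sigma_algebra i.
by rewrite -(setD0 setT); exact: sC.
Qed.

Lemma source_sigma_past i B : i \in past_index -> src i B ->
  measurable (B : set past).
Proof.
move=> ip Bi; apply: sub_sigma_algebra.
exists (fun j => if j == i then B else setT) => [j jp|].
  case: eqP => [->//|_]; have [s0 sC _] := source_sigma_algebra j.
  by rewrite -(setD0 setT); exact: sC.
apply/seteqP; split => [w Bw j _|w /(_ i)]; first by case: eqP.
by rewrite eqxx; apply; exact: ip.
Qed.

Lemma past_events_measurable : past_events `<=` measurable.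
Proof.
move=> _ [B Bi ->]; apply: fin_bigcap_measurable => // i ip.
by apply: (@source_sigma_measurable i); exact: Bi.
Qed.

Lemma past_eventsI : setI_closed past_events.
Proof.
move=> _ _ [B Bi ->] [C Ci ->]; exists (fun i => B i `&` C i); last first.
  by rewrite bigcapI.
by move=> i ip; apply: source_sigmaI; [exact: Bi|exact: Ci].
Qed.

Lemma measurable_past : measurable_fun setT (idfun : Omega -> past).
Proof.
move=> _ B mB; rewrite setTI preimage_id.
move: B mB; apply: smallest_sub; first exact: sigma_algebra_measurable.
exact: past_events_measurable.
Qed.

Lemma measurable_past_x0 : measurable_vec (x0 : past -> 'cV[R]_p).
Proof.
move=> i _ B mB; apply: (@source_sigma_past None); first by rewrite inE.
apply: sub_sigma_algebra.
by rewrite (bigD1 i)//=; left; exists B.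
Qed.

Lemma measurable_past_xi s : (s < t)%N ->
  measurable_fun setT (xi s : past -> Xi).
Proof.
move=> st _ B mB; have sT := ltn_trans st (ltn_ord t).
by apply: (@source_sigma_past (Some (Ordinal sT))); [rewrite inE|exists B].
Qed.

(** As functions of A both sides are finite measures; mutual independence makes them agree on the
    pi-system [past_events], hence on the sigma-algebra it generates. *)
Lemma past_independent (A : set past) (B : set Xi) : measurable A ->
  measurable B -> P (A `&` xi t @^-1` B) = (P A * P (xi t @^-1` B))%E.
Proof.
move=> mA mB.
have mxB : measurable (xi t @^-1` B) by exact: measurable_funPTI.
pose r : {nonneg R} := NngNum (fine_ge0 (measure_ge0 P (xi t @^-1` B))).
have rP X : mscale r P X = (P X * P (xi t @^-1` B))%E.
  by rewrite -[in RHS](@fineK _ (P (xi t @^-1` B))) ?fin_num_measure// muleC.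
rewrite -rP.
have -> : P (A `&` xi t @^-1` B) = mrestr P mxB A by [].
apply: (@g_sigma_algebra_measure_unique _ _ _ past_events
  past_events_measurable (fun=> setT)) => //.
- by move=> _; exact: past_eventsT.
- by rewrite bigcup_const.
- exact: past_eventsI.
- move=> _ [C Ci ->].
  apply: etrans (esym (rP _)); rewrite /= /mrestr.
  have tp : Some t \notin past_index by rewrite inE ltnn.
  (* Adjoining the index t, which is not in the past, to the family of past events lets independence
     be applied to the enlarged index set. *)
  pose C' i := if i == Some t then xi t @^-1` B else C i.
  have C't : C' (Some t) = xi t @^-1` B by rewrite /C' eqxx.
  have C'E i : i \in past_index -> C' i = C i.
    by rewrite /C'; case: eqP => // -> ip; rewrite ip in tp.
  have C'i i : i \in Some t |: past_index -> src i (C' i).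
    rewrite in_setU1 /C'; case: eqP => [->|_ /=]; last exact: Ci.
    by exists B => //; rewrite setTI.
  have := indep C'i; rewrite big_setU1//= (eq_bigr (P \o C)); last first.
    by move=> i ip /=; rewrite C'E.
  rewrite C't (indep Ci) muleC => <-; congr (P _).
  apply/seteqP; split => [w [Cw Bw] i|w Cw]; rewrite /=.
    by rewrite in_setU1 => /predU1P[->|ip]; rewrite ?C't ?C'E//; exact: Cw.
  split=> [i ip|]; first by rewrite -C'E//; apply: Cw; rewrite /= in_setU1 [_
    \in _]ip orbT.
  by have := Cw (Some t); rewrite C't; apply; rewrite /= in_setU1 eqxx.
- move=> _; rewrite /= /mrestr.
  by apply: le_lt_trans (probability_le1 _ _) (ltry _); exact: measurableI.
Qed.

Context (D : probability Xi R).
Hypothesis xiD : forall B, measurable B -> distribution P (xi t) B = D B.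

(** Plays the role of conditioning on the past: the joint law of the past and of the sample at time
    t is the product of the law of the past with [D], so Tonelli's theorem applies. *)
Lemma integral_freeze (H : past * Xi -> \bar R) :
  measurable_fun setT H -> (forall w, 0 <= H w)%E ->
  (\int[P]_w H (w, xi t w) = \int[P]_w \int[D]_z H (w, z))%E.
Proof.
move=> mH H0.
pose idp : {mfun Omega >-> past} :=
  HB.pack (idfun : Omega -> past) (isMeasurableFun.Build _ _ _ _ _
    measurable_past).
have mY : measurable_fun setT (fun w : Omega => (w : past, xi t w)).
  by apply: measurable_fun_pair; [exact: measurable_past|exact:
    measurable_funP].
pose Y : {mfun Omega >-> (past * Xi)%type} :=
  HB.pack (fun w : Omega => (w : past, xi t w)) (isMeasurableFun.Build _ _ _ _
    _ mY).
have YE : forall X, measurable X -> (distribution P idp \x D)%E X =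
  distribution P Y X.
  apply: product_measure_unique => A B mA mB.
  by apply: etrans (past_independent mA mB) _; congr (_ * _)%E; exact: xiD.
rewrite -[LHS](@ge0_integral_distribution _ _ _ _ _ P Y H)//.
rewrite (eq_measure_integral (distribution P idp \x D)%E); last first.
  by move=> A mA _; apply/esym/YE.
rewrite fubini_tonelli1//.
rewrite ge0_integral_distribution//.
  exact: measurable_fun_fubini_tonelli_F.
by move=> w; apply: integral_ge0.
Qed.
End freezing.

(** * One step of the method *)

Section has_mean.
Context {R : realType} {d} {W : measurableType d} (P : probability W R).
Implicit Types h k : W -> R.

(** Integrability and value are kept together so that linear combinations need no separate
    finiteness argument. *)
Definition has_mean h (m : R) : Prop :=
  P.-integrable setT (EFin \o h) /\ (\int[P]_w (h w)%:E = m%:E)%E.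

Lemma has_mean_fine h : P.-integrable setT (EFin \o h) ->
  has_mean h (fine 'E_P[h]).
Proof.
move=> ih; split => //; rewrite unlock fineK//.
by apply: integrable_fin_num.
Qed.

Lemma has_mean_inj h m n : has_mean h m -> has_mean h n -> m = n.
Proof. by move=> [_ hm] [_]; rewrite hm => -[]. Qed.

Lemma has_mean_eq h k m : h =1 k -> has_mean h m -> has_mean k m.
Proof. by move=> /funext ->. Qed.

Lemma has_mean_cst c : has_mean (fun=> c) c.
Proof.
split; first exact: finite_measure_integrable_cst.
by have := expectation_cst P c; rewrite unlock.
Qed.

Lemma has_meanD h k m n : has_mean h m -> has_mean k n ->
  has_mean (fun w => h w + k w) (m + n).
Proof.
move=> [ih hm] [ik kn]; split; first exact: (integrableD measurableT ih ik).
under eq_integral do rewrite EFinD.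
by rewrite integralD_EFin// hm kn.
Qed.

Lemma has_meanZ (a : R) h m : has_mean h m -> has_mean (fun w => a * h w) (a *
  m).
Proof.
move=> [ih hm]; split; first exact: (integrableZl measurableT a ih).
under eq_integral do rewrite EFinM.
by rewrite integralZl// hm.
Qed.

Lemma has_meanB h k m n : has_mean h m -> has_mean k n ->
  has_mean (fun w => h w - k w) (m - n).
Proof.
move=> hm /(has_meanZ (-1)); rewrite mulN1r => kn.
by apply: has_mean_eq (has_meanD hm kn) => w; rewrite mulN1r.
Qed.

Lemma has_mean_sum (I : Type) (r : seq I) (F : I -> W -> R) (n : I -> R) :
  (forall i, has_mean (F i) (n i)) ->
  has_mean (fun w => \sum_(i <- r) F i w) (\sum_(i <- r) n i).
Proof.
move=> Fn; elim: r => [|i r ih].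
  by rewrite big_nil; apply: has_mean_eq (has_mean_cst 0) => w; rewrite big_nil.
rewrite big_cons; apply: has_mean_eq (has_meanD (Fn i) ih) => w.
by rewrite big_cons.
Qed.

Lemma has_mean_le h k m n : has_mean h m -> has_mean k n ->
  (forall w, h w <= k w) -> m <= n.
Proof.
move=> [ih hm] [ik kn] hk; rewrite -lee_fin -hm -kn.
by apply: le_integral => // w _; rewrite lee_fin.
Qed.

Lemma has_mean_ge0 h m : has_mean h m -> (forall w, 0 <= h w) -> 0 <= m.
Proof. by move=> hm h0; apply: has_mean_le (has_mean_cst 0) hm h0. Qed.

Lemma has_mean_measurable h m : has_mean h m -> measurable_fun setT h.
Proof. by move=> [/measurable_int/measurable_EFinP]. Qed.

Lemma integral_le_mean h k m : measurable_fun setT h -> (forall w, 0 <= h w) ->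
  has_mean k m -> (forall w, h w <= k w) -> (\int[P]_w (h w)%:E <= m%:E)%E.
Proof.
move=> mh h0 km hk; have mk := has_mean_measurable km; rewrite -(proj2 km).
apply: ge0_le_integral => //; first by move=> w _; rewrite lee_fin.
- exact/measurable_EFinP.
- exact/measurable_EFinP.
- by move=> w _; rewrite lee_fin.
Qed.

Lemma ge0_has_mean h : measurable_fun setT h -> (forall w, 0 <= h w) ->
  (\int[P]_w (h w)%:E < +oo)%E -> has_mean h (fine 'E_P[h]).
Proof.
move=> mh h0 hoo; apply: has_mean_fine; apply/integrableP; split.
  exact/measurable_EFinP.
by under eq_integral do rewrite /= ger0_norm//.
Qed.

Lemma has_mean_dominated h k m : measurable_fun setT h ->
  (forall w, 0 <= h w) -> has_mean k m -> (forall w, h w <= k w) ->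
  has_mean h (fine 'E_P[h]) /\ fine 'E_P[h] <= m.
Proof.
move=> mh h0 km hk; have hm := integral_le_mean mh h0 km hk.
have hh : has_mean h (fine 'E_P[h]).
  by apply: ge0_has_mean => //; apply: le_lt_trans hm (ltry _).
by split => //; apply: has_mean_le hh km hk.
Qed.

End has_mean.

(** * Mean bounds for a gradient step from a fixed point *)

Section one_step.
Context {R : realType} {p m : nat} {dX} {Xi : measurableType dX}
  (D : probability Xi R) (A : 'M[R]_(p, m)) (f : 'cV[R]_p -> Xi -> R)
  (L mu : R) (xs : 'cV[R]_p).

Let F := objective D f.
Let Q := feasible_proj A.
Let g := sgrad f.

Hypothesis nontrivial : exists2 x, feasible A x & x != 0.
Hypothesis fint : forall x, D.-integrable setT (EFin \o f x).
Hypothesis fdiff : forall z x, differentiable (f ^~ z) x.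
Hypothesis gint : forall x i,
  D.-integrable setT (fun z => (sgrad f x z i 0)%:E).
Hypothesis gmean : forall x i,
  'E_D[(fun z => sgrad f x z i 0)%R]%E = (grad F x i 0)%:E.
Hypothesis fconvex : forall z, convex_function [set: 'cV[R]_p] (f ^~ z).
Hypothesis L0 : 0 < L.
Hypothesis gL : forall z x y,
  enorm (sgrad f y z - sgrad f x z) <= L * enorm (x - y).
Hypothesis mu0 : 0 <= mu.
Hypothesis Fmu : forall x y,
  F y - F x >= dotp (grad F x) (y - x) + mu / 2 * enorm (x - y) ^+ 2.
Hypothesis xsA : feasible A xs.
Hypothesis xs_min : forall x, feasible A x -> F xs <= F x.
Hypothesis var_perp : (grad_var D f (feasible A) xs < +oo)%E.
Hypothesis var_A : (grad_var D f (colspace A) xs < +oo)%E.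
Hypothesis gradA : forall x, feasible A x ->
  orth_proj (colspace A) (grad F x) = 0.

Let sp := fine (grad_var D f (feasible A) xs).
Let sA := fine (grad_var D f (colspace A) xs).

Lemma sample_lower z x y : f x z + dotp (g x z) (y - x) <= f y z.
Proof. exact: convex_grad_lower. Qed.

Lemma sample_upper z x y :
  f y z <= f x z + dotp (g x z) (y - x) + L / 2 * dotp (y - x) (y - x).
Proof. apply: (@lipschitz_grad_upper _ _ L (f ^~ z) x y); first exact: ltW.
  exact: fdiff.
exact: gL. Qed.

Lemma sample_mean x : has_mean D (f x) (F x).
Proof. exact: has_mean_fine. Qed.

Lemma sgrad_mean x v : has_mean D (fun z => dotp (g x z) v) (dotp (grad F x) v).
Proof.
apply: has_mean_sum => i; rewrite mulrC.
apply: (@has_mean_eq _ _ _ _ (fun z => v i 0 * g x z i 0)) => [z|].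
  by rewrite mulrC.
apply: has_meanZ; split; first exact: gint.
by rewrite -gmean unlock.
Qed.

Lemma measurable_sgrad x : measurable_vec (g x).
Proof. by move=> i; have /measurable_int/measurable_EFinP := gint x i. Qed.

Lemma objective_upper x y :
  F y <= F x + dotp (grad F x) (y - x) + L / 2 * dotp (y - x) (y - x).
Proof.
have H := has_meanD (has_meanD (sample_mean x) (sgrad_mean x (y - x)))
  (has_mean_cst D (L / 2 * dotp (y - x) (y - x))).
by apply: has_mean_le (sample_mean y) H _ => z; exact: sample_upper.
Qed.

Lemma objective_strong x y :
  F x + dotp (grad F x) (y - x) + mu / 2 * dotp (y - x) (y - x) <= F y.
Proof. by have := Fmu x y; rewrite enorm_sqr -opprB !dotpE; lra. Qed.

Lemma objective_lower x y : F x + dotp (grad F x) (y - x) <= F y.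
Proof.
apply: le_trans (objective_strong x y); rewrite lerDl mulr_ge0 ?dotp_ge0//.
by rewrite divr_ge0.
Qed.

(** The quadratic lower and upper bounds at 0 are compared at a nonzero vector. *)
Lemma mu_le_L : mu <= L.
Proof.
have [x _ x0] := nontrivial.
have := le_trans (objective_strong 0 x) (objective_upper 0 x).
rewrite subr0 lerD2l ler_pM2r ?ler_pM2r//.
rewrite lt_def dotp_ge0 andbT; apply: contra_neq x0; exact: dotp_eq0.
Qed.

(* A projected gradient step of length 1/L from the constrained minimizer
   cannot decrease F. *)
Lemma proj_grad_min : Q *m grad F xs = 0.
Proof.
set G := Q *m grad F xs.
have GA : feasible A G by exact: proj_feasible.
have := objective_upper xs (xs - L^-1 *: G).
have := xs_min (feasibleB xsA (feasibleZ L^-1 GA)).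
rewrite [xs - _ - xs]addrAC subrr add0r !(dotpNr, dotpNl, dotpZl, dotpZr).
rewrite -(dotp_proj (grad F xs) GA) -/Q -/G => H1 H2.
apply: dotp_eq0; apply/eqP; rewrite eq_le dotp_ge0 andbT.
have {H2} : F xs <= F xs - L^-1 * dotp G G / 2.
  apply: le_trans H1 (le_trans H2 _); rewrite le_eqVlt; apply/orP; left.
  by apply/eqP; field; rewrite gt_eqF.
rewrite lerDl oppr_ge0 pmulr_lle0 ?invr_gt0 ?ltr0n//.
by rewrite pmulr_rle0 ?invr_gt0.
Qed.

Lemma grad_min_orth y : feasible A y -> dotp (grad F xs) (y - xs) = 0.
Proof.
move=> yA; rewrite -(dotp_proj _ (feasibleB yA xsA)).
by rewrite -/Q proj_grad_min dotp0l.
Qed.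

Lemma grad_feasible y x : feasible A y -> dotp (grad F y) (x - Q *m x) = 0.
Proof.
move=> yA; have := gradA yA; rewrite orth_proj_colspace => /eqP.
rewrite subr_eq0 => /eqP ->.
by rewrite (feasible_orth_colspace (proj_feasible _ _) (proj_colspace _ _)).
Qed.

Lemma gap_ge0 y : feasible A y -> 0 <= F y - F xs.
Proof. by move=> /xs_min; rewrite subr_ge0. Qed.

Lemma gap_le y : feasible A y -> F y - F xs <= L / 2 * dotp (y - xs) (y - xs).
Proof. by move=> yA; have := objective_upper xs y; rewrite grad_min_orth//;
  lra. Qed.

Lemma sp_mean :
  has_mean D (fun z => dotp (Q *m g xs z) (Q *m g xs z)) sp.
Proof.
have E : (fun z => dotp (Q *m g xs z) (Q *m g xs z)) =
    (fun z => enorm (orth_proj (feasible A) (sgrad f xs z)) ^+ 2).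
  by apply/funext => z; rewrite orth_proj_feasible enorm_sqr.
rewrite /sp /grad_var -E; apply: ge0_has_mean.
- have mg := measurable_vec_mulmx Q (measurable_sgrad xs); exact:
  measurable_dotp.
- by move=> z; exact: dotp_ge0.
- by move: var_perp; rewrite /grad_var -E unlock.
Qed.

Lemma sA_mean : has_mean D
  (fun z => dotp (g xs z - Q *m g xs z) (g xs z - Q *m g xs z)) sA.
Proof.
have E : (fun z => dotp (g xs z - Q *m g xs z) (g xs z - Q *m g xs z)) =
    (fun z => enorm (orth_proj (colspace A) (sgrad f xs z)) ^+ 2).
  by apply/funext => z; rewrite orth_proj_colspace enorm_sqr.
rewrite /sA /grad_var -E; apply: ge0_has_mean.
- have mg := measurable_sgrad xs; apply: measurable_dotp;
  by apply: measurable_vecB => //; exact: measurable_vec_mulmx.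
- by move=> z; exact: dotp_ge0.
- by move: var_A; rewrite /grad_var -E unlock.
Qed.

Lemma dotp_sum3 (a b c : 'cV[R]_p) :
  dotp (a + b + c) (a + b + c) <= 3 * dotp a a + 3 * dotp b b + 3 * dotp c c.
Proof.
have := dotp_ge0 (a - b); have := dotp_ge0 (a - c); have := dotp_ge0 (b - c).
by rewrite !dotpE (dotpC b a) (dotpC c a) (dotpC c b); lra.
Qed.

Lemma proj_contract u : dotp (Q *m u) (Q *m u) <= dotp u u.
Proof. by rewrite [leRHS](dotp_pythagoras A) lerDl dotp_ge0. Qed.

Lemma proj_compl_contract u : dotp (u - Q *m u) (u - Q *m u) <= dotp u u.
Proof. by rewrite [leRHS](dotp_pythagoras A) lerDr dotp_ge0. Qed.

Lemma sgrad_lipschitz z x y :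
  dotp (g x z - g y z) (g x z - g y z) <= L ^+ 2 * dotp (x - y) (x - y).
Proof.
have := gL z y x; rewrite enorm_le; last first.
  by apply: mulr_ge0; [exact: ltW|exact: sqrtr_ge0].
by rewrite exprMn enorm_sqr -[y - x]opprB dotpNl dotpNr opprK.
Qed.

Lemma sample_cocoercive z x y :
  dotp (g x z - g y z) (g x z - g y z) <=
  2 * L * (f x z - f y z - dotp (g y z) (x - y)).
Proof.
by apply: cocoercive (sample_upper z) => //; exact: sample_lower.
Qed.

(** Add cocoercivity for (x, y) and for (y, x); the function values cancel. *)
Lemma sample_cocoercive_sym z x y :
  dotp (g x z - g y z) (g x z - g y z) <= L * dotp (g x z - g y z) (x - y).
Proof.
have := sample_cocoercive z x y; have := sample_cocoercive z y x.
rewrite -[y - x]opprB -[g y z - g x z]opprB dotpNl !dotpNr opprK.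
rewrite [dotp (g x z - g y z) (x - y)]dotpDl dotpNl.
move: (dotp _ _) (dotp _ _) (dotp _ _) => a b c; lra.
Qed.

(** The three pieces of g(x) contribute 3 L^2 |x - y|^2, 6 L times the Bregman divergence of the
    sample from xs to y, and 3 times the noise at xs. That divergence has mean F(y) - F(xs). Since L
    eta <= 1/10, the descent coefficient is 2 - 6/10 = 7/5 and the residual one is 1 + 3/10 =
    13/10. *)
Lemma proj_step_bound (eta : R) x y : y = Q *m x -> 0 < eta -> 10 * L * eta <=
  1 ->
  (\int[D]_z (dotp (Q *m (x - eta *: g x z) - xs)
                   (Q *m (x - eta *: g x z) - xs))%:E <=
   ((1 - mu * eta) * dotp (y - xs) (y - xs) - 7 / 5 * eta * (F y - F xs)
    + 13 / 10 * eta * L * dotp (x - y) (x - y) + 3 * eta ^+ 2 * sp)%:E)%E.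
Proof.
move=> yE eta0 step.
have yA : feasible A y by rewrite yE; exact: proj_feasible.
pose k z := dotp (y - xs) (y - xs) + 3 * eta ^+ 2 * (L ^+ 2 * dotp (x - y) (x -
  y))
  + -2 * eta * dotp (g x z) (y - xs)
  + 6 * L * eta ^+ 2 * (f y z - f xs z - dotp (g xs z) (y - xs))
  + 3 * eta ^+ 2 * dotp (Q *m g xs z) (Q *m g xs z).
have km : has_mean D k (dotp (y - xs) (y - xs)
  + 3 * eta ^+ 2 * (L ^+ 2 * dotp (x - y) (x - y))
  + -2 * eta * dotp (grad F x) (y - xs)
  + 6 * L * eta ^+ 2 * (F y - F xs - dotp (grad F xs) (y - xs))
  + 3 * eta ^+ 2 * sp).
  apply: has_meanD; last exact/has_meanZ/sp_mean.
  apply: has_meanD.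
    apply: has_meanD; first exact: has_mean_cst.
    exact/has_meanZ/sgrad_mean.
  apply: has_meanZ; apply: has_meanB; last exact: sgrad_mean.
  by apply: has_meanB; exact: sample_mean.
apply: le_trans (integral_le_mean _ _ km _) _.
- have mx : measurable_vec (fun z => Q *m (x - eta *: g x z) - xs).
    apply: measurable_vecB; last exact: measurable_vec_cst.
    apply: measurable_vec_mulmx; apply: measurable_vecB.
      exact: measurable_vec_cst.
    by apply: measurable_vecZ; exact: measurable_sgrad.
  exact: measurable_dotp.
- by move=> z; exact: dotp_ge0.
- move=> z; rewrite mulmxBr -yE -scalemxAr addrAC.
  have -> : dotp (y - xs - eta *: (Q *m g x z)) (y - xs - eta *: (Q *m g x z)) =
      dotp (y - xs) (y - xs) - 2 * eta * dotp (g x z) (y - xs)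
      + eta ^+ 2 * dotp (Q *m g x z) (Q *m g x z).
    rewrite -(dotp_proj (g x z) (feasibleB yA xsA)) -/Q.
    move: (y - xs) (Q *m g x z) => u v; rewrite !dotpE (dotpC u v); ring.
  have : dotp (Q *m g x z) (Q *m g x z) <= 3 * (L ^+ 2 * dotp (x - y) (x - y))
      + 6 * L * (f y z - f xs z - dotp (g xs z) (y - xs))
      + 3 * dotp (Q *m g xs z) (Q *m g xs z).
    have -> : Q *m g x z = Q *m (g x z - g y z) + Q *m (g y z - g xs z)
        + Q *m g xs z.
      by rewrite -!mulmxDr addrA !subrK.
    apply: le_trans (dotp_sum3 _ _ _) _.
    have H1 := le_trans (proj_contract _) (sgrad_lipschitz z x y).
    have H2 := le_trans (proj_contract _) (sample_cocoercive z y xs).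
    apply: lerD => //; apply: lerD; first by rewrite ler_pM2l.
    have -> : (6 : R) = 3 * 2 by rewrite -natrM.
    by rewrite -!mulrA ler_pM2l// mulrA.
  move=> /(ler_wpM2l (sqr_ge0 eta)); rewrite /k; lra.
- rewrite lee_fin (grad_min_orth yA) subr0.
  have H1 := objective_strong x xs; have H2 := objective_upper x y.
  (* Passes from |x - xs|, where strong convexity acts, to |y - xs|, using y - xs = Q (x - xs). *)
  have H3 : dotp (y - xs) (y - xs) <= dotp (xs - x) (xs - x).
    have -> : y - xs = Q *m (x - xs) by rewrite mulmxBr (proj_id xsA) yE.
    by apply: le_trans (proj_contract _) _; rewrite -opprB dotpNl dotpNr opprK.
  have E : dotp (grad F x) (y - xs) =
      dotp (grad F x) (y - x) - dotp (grad F x) (xs - x).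
    by rewrite -dotpNr -dotpDr opprB addrA subrK.
  have H4 : dotp (y - x) (y - x) = dotp (x - y) (x - y).
    by rewrite -opprB dotpNl dotpNr opprK.
  rewrite H4 in H2.
  have {H3}H3 : mu / 2 * dotp (y - xs) (y - xs) <= mu / 2 * dotp (xs - x) (xs -
    x).
    by apply: ler_wpM2l => //; rewrite divr_ge0.
  have d0 := gap_ge0 yA; have z0 := dotp_ge0 (x - y).
  rewrite E; move: H1 H2 H3 d0 z0.
  move: (dotp (x - y) _) (dotp (y - xs) _) (dotp (xs - x) _) => Z Y X.
  move: (dotp _ _) (dotp _ _) (F y) (F xs) (F x) => a b Fy Fs Fx.
  move=> H1 H2 H3 d0 z0.
  have H5 : mu / 2 * Y + (Fy - Fs) - L / 2 * Z <= a - b by lra.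
  have := ler_wpM2l (ltW eta0) H5.
  have Leta0 : 0 < L * eta by rewrite mulr_gt0.
  have : L * eta * (eta * (Fy - Fs)) <= 1 / 10 * (eta * (Fy - Fs)).
    by apply: ler_wpM2r; [rewrite mulr_ge0// ltW|lra].
  have : L * eta * (L * eta * Z) <= 1 / 10 * (L * eta * Z).
    by apply: ler_wpM2r; [rewrite mulr_ge0// ltW|lra].
  lra.
Qed.

(** The cross term is split at y: <g(y), x - y> has mean 0 because the mean gradient at the feasible
    point y is feasible, and the monotone remainder absorbs the second-order term in g(x) - g(y).
    Hence |x - y|^2 enters with coefficient exactly 1. *)
Lemma residual_step_bound (eta : R) x y : y = Q *m x -> 0 < eta -> 10 * L * eta
  <= 1 ->
  (\int[D]_z (dotp (x - eta *: g x z - Q *m (x - eta *: g x z))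
                   (x - eta *: g x z - Q *m (x - eta *: g x z)))%:E <=
   (dotp (x - y) (x - y) + eta ^+ 2 * (6 * L * (F y - F xs) + 3 * sA))%:E)%E.
Proof.
move=> yE eta0 step.
have yA : feasible A y by rewrite yE; exact: proj_feasible.
pose C (u : 'cV[R]_p) := u - Q *m u.
pose k z := dotp (x - y) (x - y) + -2 * eta * dotp (g y z) (x - y)
  + 6 * L * eta ^+ 2 * (f y z - f xs z - dotp (g xs z) (y - xs))
  + 3 * eta ^+ 2 * dotp (g xs z - Q *m g xs z) (g xs z - Q *m g xs z).
have km : has_mean D k (dotp (x - y) (x - y) + -2 * eta * dotp (grad F y) (x -
  y)
  + 6 * L * eta ^+ 2 * (F y - F xs - dotp (grad F xs) (y - xs))
  + 3 * eta ^+ 2 * sA).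
  apply: has_meanD; last exact/has_meanZ/sA_mean.
  apply: has_meanD.
    apply: has_meanD; first exact: has_mean_cst.
    exact/has_meanZ/sgrad_mean.
  apply: has_meanZ; apply: has_meanB; last exact: sgrad_mean.
  by apply: has_meanB; exact: sample_mean.
apply: le_trans (integral_le_mean _ _ km _) _.
- have mx : measurable_vec (fun z => x - eta *: g x z).
    apply: measurable_vecB; first exact: measurable_vec_cst.
    by apply: measurable_vecZ; exact: measurable_sgrad.
  by apply: measurable_dotp; apply: measurable_vecB => //; exact:
    measurable_vec_mulmx.
- by move=> z; exact: dotp_ge0.
- move=> z; rewrite mulmxBr -yE -scalemxAr.
  have -> : x - eta *: g x z - (y - eta *: (Q *m g x z)) =
      (x - y) - eta *: C (g x z).
    rewrite /C; move: (Q *m g x z) (g x z) => a b.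
    by apply/matrixP => i j; rewrite !mxE; ring.
  have Cxy : dotp (C (g x z)) (x - y) = dotp (g x z) (x - y).
    rewrite /C dotpDl dotpNl (feasible_orth_colspace (proj_feasible _ _))
      ?subr0//.
    by rewrite yE; exact: proj_colspace.
  have -> : dotp (x - y - eta *: C (g x z)) (x - y - eta *: C (g x z)) =
      dotp (x - y) (x - y) - 2 * eta * dotp (g x z) (x - y)
      + eta ^+ 2 * dotp (C (g x z)) (C (g x z)).
    rewrite -Cxy; move: (x - y) (C (g x z)) => u v.
    by rewrite !dotpE (dotpC u v); ring.
  have E : dotp (g x z) (x - y) = dotp (g y z) (x - y)
      + dotp (g x z - g y z) (x - y).
    by rewrite -dotpDl [g y z + _]addrC subrK.
  have : dotp (C (g x z)) (C (g x z)) <=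
      3 * (L * dotp (g x z - g y z) (x - y))
      + 6 * L * (f y z - f xs z - dotp (g xs z) (y - xs))
      + 3 * dotp (C (g xs z)) (C (g xs z)).
    have -> : C (g x z) = C (g x z - g y z) + C (g y z - g xs z) + C (g xs z).
      rewrite /C !mulmxBr; move: (Q *m g x z) (Q *m g y z) (Q *m g xs z).
      move: (g x z) (g y z) (g xs z) => a b c a' b' c'.
      by apply/matrixP => i j; rewrite !mxE; ring.
    apply: le_trans (dotp_sum3 _ _ _) _.
    have H1 := le_trans (proj_compl_contract _) (sample_cocoercive_sym z x y).
    have H2 := le_trans (proj_compl_contract _) (sample_cocoercive z y xs).
    apply: lerD => //; apply: lerD; first by rewrite ler_pM2l.
    have -> : (6 : R) = 3 * 2 by rewrite -natrM.
    by rewrite -!mulrA ler_pM2l// mulrA.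
  have mono : 0 <= dotp (g x z - g y z) (x - y).
    have := sample_cocoercive_sym z x y => /(le_trans (dotp_ge0 _)).
    by rewrite pmulr_rge0.
  move=> /(ler_wpM2l (sqr_ge0 eta)) H; rewrite /k -/(C (g xs z)) E.
  apply: le_trans (lerD (lexx _) H) _; rewrite -subr_ge0.
  (* The monotone term keeps the factor 2 - 3 L eta, positive because L eta <= 1/10. *)
  have b0 : 0 <= dotp (g x z - g y z) (x - y) * eta * (2 - 3 * (L * eta)).
    by apply: mulr_ge0; [rewrite mulr_ge0// ltW|lra].
  by apply: le_trans b0 _; rewrite le_eqVlt; apply/orP; left; apply/eqP; ring.
- rewrite lee_fin (grad_min_orth yA) subr0.
  have := grad_feasible x yA; rewrite -yE => ->; lra.
Qed.

End one_step.

(** * The run *)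

Section run.
Context {R : realType} {p m : nat} {dX dO : measure_display}
  {Xi : measurableType dX} {Omega : measurableType dO}
  (D : probability Xi R) (P : probability Omega R)
  (A : 'M[R]_(p, m)) (f : 'cV[R]_p -> Xi -> R) (L mu : R)
  (xs : 'cV[R]_p) (T E : nat) (IT : seq nat)
  (x0 : Omega -> 'cV[R]_p) (xi : nat -> {RV P >-> Xi}).

Let F := objective D f.
Let Q := feasible_proj A.
Let g := sgrad f.

Hypothesis nontrivial : exists2 x, feasible A x & x != 0.
Hypothesis fint : forall x, D.-integrable setT (EFin \o f x).
Hypothesis fdiff : forall z x, differentiable (f ^~ z) x.
Hypothesis gint : forall x i,
  D.-integrable setT (fun z => (sgrad f x z i 0)%:E).
Hypothesis gmean : forall x i,
  'E_D[(fun z => sgrad f x z i 0)%R]%E = (grad F x i 0)%:E.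
Hypothesis fconvex : forall z, convex_function [set: 'cV[R]_p] (f ^~ z).
Hypothesis L0 : 0 < L.
Hypothesis gL : forall z x y,
  enorm (sgrad f y z - sgrad f x z) <= L * enorm (x - y).
Hypothesis mu0 : 0 <= mu.
Hypothesis Fmu : forall x y,
  F y - F x >= dotp (grad F x) (y - x) + mu / 2 * enorm (x - y) ^+ 2.
Hypothesis xsA : feasible A xs.
Hypothesis xs_min : forall x, feasible A x -> F xs <= F x.
Hypothesis var_perp : (grad_var D f (feasible A) xs < +oo)%E.
Hypothesis var_A : (grad_var D f (colspace A) xs < +oo)%E.
Hypothesis gradA : forall x, feasible A x ->
  orth_proj (colspace A) (grad F x) = 0.
Hypothesis T1 : (1 <= T)%N.
Hypothesis gapE : gap T IT = E.
Hypothesis E1 : (1 <= E)%N.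
Hypothesis mx0 : measurable_vec x0.
Hypothesis x0A : forall w, feasible A (x0 w).
Hypothesis xiD : forall t, (t < T)%N -> forall B, measurable B ->
  distribution P (xi t) B = D B.
Hypothesis indep : mutually_independent P
  (source_sigma (T := T) x0 (fun t => xi t : Omega -> Xi)).
Hypothesis dist0 : (init_dist P A x0 xs < +oo)%E.

Let sp := fine (grad_var D f (feasible A) xs).
Let sA := fine (grad_var D f (colspace A) xs).

Let Fup := objective_upper fint fdiff gint gmean L0 gL.
Let Flo := objective_lower mu0 Fmu.

Lemma measurable_objective d (W : measurableType d) (u : W -> 'cV[R]_p) :
  measurable_vec u -> measurable_fun setT (F \o u).
Proof. exact: (measurable_fun_smooth_convex L0 Flo Fup). Qed.

Lemma coord_le_enorm (x : 'cV[R]_p) i : `|x i 0| <= enorm x.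
Proof.
rewrite -(ler_pXn2r (ltn0Sn 1)) ?nnegrE ?sqrtr_ge0// enorm_sqr.
rewrite real_normK ?num_real// /dotp (bigD1 i)//= -expr2 lerDl.
by apply: sumr_ge0 => j _; rewrite -expr2 sqr_ge0.
Qed.

Lemma measurable_sgrad_comp d (W : measurableType d) (u : W -> 'cV[R]_p)
    (v : W -> Xi) : measurable_vec u -> measurable_fun setT v ->
  measurable_vec (fun w => g (u w) (v w)).
Proof.
move=> mu' mv i.
apply: (@measurable_fun_lipschitz _ _ _ _ _ _ (fun x z => g x z i 0) L) => //.
  by move=> x; exact: (measurable_sgrad gint).
move=> z x y; have := coord_le_enorm (g x z - g y z) i; rewrite !mxE.
move=> /le_trans; apply; apply: le_trans (gL z y x) _.
by rewrite /enorm -[y - x]opprB dotpNl dotpNr opprK.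
Qed.

Section process.
Variable eta : R.

Let X (y0 : 'cV[R]_p) (z : nat -> Xi) t := dpsgd A f IT (fun=> eta) y0 z t.

(** Stated over an arbitrary space and with only the samples before t, so that it applies to [Omega]
    and to [past] alike. *)
Lemma measurable_dpsgd d (W : measurableType d) (y0 : W -> 'cV[R]_p)
    (z : nat -> W -> Xi) t : measurable_vec y0 ->
  (forall s, (s < t)%N -> measurable_fun setT (z s)) ->
  measurable_vec (fun w => X (y0 w) (z ^~ w) t).
Proof.
move=> my0; elim: t => [//|t ih] mz.
have mX := ih (fun s st => mz s (ltnW st)).
have mX' : measurable_vec (fun w => X (y0 w) (z ^~ w) t
    - eta *: g (X (y0 w) (z ^~ w) t) (z t w)).
  apply: measurable_vecB => //; apply: measurable_vecZ.
  by apply: measurable_sgrad_comp => //; exact: mz.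
rewrite /X /=; case: (t.+1 \in IT) => //.
have := measurable_vec_mulmx Q mX'; congr measurable_vec.
by apply/funext => w; rewrite orth_proj_feasible.
Qed.

Let x t w := X (x0 w) (xi ^~ w) t.
Let y t w := Q *m x t w.
Let step t w z := x t w - eta *: g (x t w) z.
Let phi t w := dotp (y t w - xs) (y t w - xs).
Let psi t w := dotp (x t w - y t w) (x t w - y t w).
Let dd t w := F (y t w) - F xs.

Lemma measurable_iterate t : measurable_vec (x t).
Proof. by apply: measurable_dpsgd => // s _; exact: measurable_funP. Qed.

Lemma proj_iterate_feasible t w : feasible A (y t w). Proof. exact:
  proj_feasible. Qed.

Lemma sqdist_ge0 t w : 0 <= phi t w. Proof. exact: dotp_ge0. Qed.

Lemma residual_ge0 t w : 0 <= psi t w. Proof. exact: dotp_ge0. Qed.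

Lemma iterate_gap_ge0 t w : 0 <= dd t w.
Proof. exact: (gap_ge0 xs_min (proj_iterate_feasible t w)). Qed.

Lemma measurable_proj_iterate t : measurable_vec (y t).
Proof. exact/measurable_vec_mulmx/measurable_iterate. Qed.

Lemma measurable_iterate_gap t : measurable_fun setT (dd t).
Proof.
apply: measurable_funB => //; apply: measurable_objective.
exact: measurable_proj_iterate.
Qed.

Lemma iterate_recS t w : x t.+1 w =
  if t.+1 \in IT then Q *m step t w (xi t w) else step t w (xi t w).
Proof.
by rewrite /x /X /=; case: ifP => // _; rewrite orth_proj_feasible.
Qed.

(** Idempotence of the projection: synchronizing or not affects the residual only, never y. *)
Lemma proj_iterate_recS t w : y t.+1 w = Q *m step t w (xi t w).
Proof.
by rewrite /y iterate_recS; case: ifP => // _; rewrite (proj_id (proj_feasible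
  _ _)).
Qed.

Lemma residual_recS t w : psi t.+1 w = if t.+1 \in IT then 0 else
  dotp (step t w (xi t w) - Q *m step t w (xi t w))
       (step t w (xi t w) - Q *m step t w (xi t w)).
Proof.
rewrite /psi proj_iterate_recS iterate_recS; case: ifP => // _.
by rewrite subrr dotp0l.
Qed.

(* The iterate x_t depends on the past only, so its next sample can be
   integrated out first. *)
Lemma freeze_step (t : 'I_T) (q : 'cV[R]_p -> R) (k : Omega -> R) (n : R) :
  (forall d (W : measurableType d) (u : W -> 'cV[R]_p), measurable_vec u ->
     measurable_fun setT (q \o u)) ->
  (forall u, 0 <= q u) -> has_mean P k n ->
  (forall w, \int[D]_z (q (step t w z))%:E <= (k w)%:E)%E ->
  has_mean P (fun w => q (step t w (xi t w)))
    (fine 'E_P[fun w => q (step t w (xi t w))]) /\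
  fine 'E_P[fun w => q (step t w (xi t w))] <= n.
Proof.
move=> mq q0 kn qk.
have mstep d (W : measurableType d) (u : W -> 'cV[R]_p) (v : W -> Xi) :
    measurable_vec u -> measurable_fun setT v ->
    measurable_fun setT (fun w => q (u w - eta *: g (u w) (v w))).
  move=> mu' mv; apply: mq; apply: measurable_vecB => //.
  by apply: measurable_vecZ; exact: measurable_sgrad_comp.
(* Measurability with respect to the past, not merely on [Omega], is what allows the sample at time
   t to be integrated out. *)
have mxt : measurable_vec (x t : past x0 xi t -> 'cV[R]_p).
  apply: (@measurable_dpsgd _ (past x0 xi t) x0 (fun s => xi s)).
    exact: measurable_past_x0.
  by move=> s st; exact: measurable_past_xi.
pose H (wz : past x0 xi t * Xi) := q (step t wz.1 wz.2).
have mH : measurable_fun setT H.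
  apply: mstep => //.
  by move=> i; apply: (measurableT_comp (mxt i)); exact: measurable_fst.
have intn : (\int[P]_w (q (step t w (xi t w)))%:E <= n%:E)%E.
  rewrite -(proj2 kn).
  have -> : (\int[P]_w (q (step t w (xi t w)))%:E =
             \int[P]_w \int[D]_z (EFin \o H) (w, z))%E.
    apply: (integral_freeze mx0 indep (xiD (ltn_ord t)) (H := EFin \o H)).
      exact/measurable_EFinP.
    by move=> w; rewrite lee_fin q0.
  apply: ge0_le_integral => //.
  - by move=> w _; apply: integral_ge0 => z _; rewrite lee_fin q0.
  - have mF : measurable_fun setT
        (fun w : past x0 xi t => \int[D]_z (EFin \o H) (w, z))%E.
      apply: (@measurable_fun_fubini_tonelli_F _ _ _ _ _ D (EFin \o H)).
        exact/measurable_EFinP.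
      by move=> w; rewrite lee_fin q0.
    exact: (measurableT_comp mF (measurable_past (t := t) mx0)).
  - exact/measurable_EFinP/(has_mean_measurable kn).
  - by move=> w _; exact: qk.
have hm : has_mean P (fun w => q (step t w (xi t w)))
    (fine 'E_P[fun w => q (step t w (xi t w))]).
  apply: ge0_has_mean; last exact: le_lt_trans intn (ltry _).
    by apply: mstep; [exact: measurable_iterate|exact: measurable_funP].
  by move=> w; exact: q0.
split=> //; rewrite -lee_fin -(proj2 hm); exact: intn.
Qed.

Let r t := fine 'E_P[phi t].
Let z t := fine 'E_P[psi t].
Let d t := fine 'E_P[dd t].

Hypothesis eta0 : 0 < eta.
Hypothesis eta_small : small_step L mu E eta.

Let q := 1 - mu * eta.

Lemma mu_eta_le : mu * eta <= 1 / 10.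
Proof.
have [step10 _] := eta_small.
have muL := mu_le_L nontrivial fint fdiff gint gmean L0 gL Fmu.
have : mu * eta <= L * eta by rewrite ler_pM2r.
by move: step10; lra.
Qed.

Lemma sqdist0_mean : has_mean P (phi 0) (fine (init_dist P A x0 xs)).
Proof.
have phi0E : phi 0 = fun w => enorm (orth_proj (feasible A) (x0 w) - xs) ^+ 2.
  by apply/funext => w; rewrite /phi /y orth_proj_feasible enorm_sqr.
rewrite /init_dist -phi0E; apply: ge0_has_mean.
- apply: measurable_dotp;
  by apply: measurable_vecB; [exact: measurable_proj_iterate|exact:
    measurable_vec_cst].
- exact: sqdist_ge0.
- by move: dist0; rewrite /init_dist -phi0E unlock.
Qed.

(** Time 0 counts as a synchronization because the initial point is feasible, in agreement with the
    entry 0 in [gap]. *)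
Lemma residual_sync t : t = 0%N \/ t \in IT -> psi t = fun=> 0.
Proof.
move=> tI; apply/funext => w; case: t tI => [_|t [//|tI]].
  by rewrite /psi /y (proj_id (x0A w)) subrr dotp0l.
by rewrite residual_recS tI.
Qed.

(** Integrability of the objective gap comes from smoothness: the gap is at most L/2 |y_t -
    xs|^2. *)
Lemma iterate_gap_mean t : has_mean P (phi t) (r t) -> has_mean P (dd t) (d t).
Proof.
move=> /(has_meanZ (L / 2)) H.
have := has_mean_dominated (measurable_iterate_gap t) (iterate_gap_ge0 t) H.
case=> // w.
exact: (gap_le fint fdiff gint gmean L0 gL xsA xs_min (proj_iterate_feasible t
  w)).
Qed.

Lemma mean_step t : (t < T)%N -> has_mean P (phi t) (r t) ->
  has_mean P (psi t) (z t) ->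
  [/\ has_mean P (phi t.+1) (r t.+1), has_mean P (psi t.+1) (z t.+1),
    r t.+1 <= q * r t - 7 / 5 * eta * d t + 13 / 10 * eta * L * z t
              + 3 * eta ^+ 2 * sp &
    z t.+1 <= z t + eta ^+ 2 * (6 * L * d t + 3 * sA)].
Proof.
move=> tT phim psim; have ddm := iterate_gap_mean phim.
have [step10 _] := eta_small.
pose q1 u := dotp (Q *m u - xs) (Q *m u - xs).
pose q2 u := dotp (u - Q *m u) (u - Q *m u).
have mq1 d' (W : measurableType d') (u : W -> 'cV[R]_p) : measurable_vec u ->
    measurable_fun setT (q1 \o u).
  move=> mu'; apply: measurable_dotp; apply: measurable_vecB;
    by [exact: measurable_vec_mulmx|exact: measurable_vec_cst].
have mq2 d' (W : measurableType d') (u : W -> 'cV[R]_p) : measurable_vec u ->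
    measurable_fun setT (q2 \o u).
  by move=> mu'; apply: measurable_dotp; apply: measurable_vecB => //;
    exact: measurable_vec_mulmx.
have H1 : has_mean P (fun w => q * phi t w - 7 / 5 * eta * dd t w
    + 13 / 10 * eta * L * psi t w + 3 * eta ^+ 2 * sp)
    (q * r t - 7 / 5 * eta * d t + 13 / 10 * eta * L * z t + 3 * eta ^+ 2 * sp).
  apply: has_meanD; last exact: has_mean_cst.
  by apply: has_meanD; [apply: has_meanB|]; exact: has_meanZ.
have H2 : has_mean P (fun w => psi t w + eta ^+ 2 * (6 * L * dd t w + 3 * sA))
    (z t + eta ^+ 2 * (6 * L * d t + 3 * sA)).
  apply: has_meanD => //; apply: has_meanZ; apply: has_meanD.
    exact: has_meanZ.
  exact: has_mean_cst.
have [phim' rle] : has_mean P (phi t.+1) (r t.+1) /\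
    r t.+1 <= q * r t - 7 / 5 * eta * d t + 13 / 10 * eta * L * z t
              + 3 * eta ^+ 2 * sp.
  have phiE : phi t.+1 = fun w => q1 (step t w (xi t w)).
    by apply/funext => w; rewrite /phi proj_iterate_recS.
  rewrite /r phiE; apply: (@freeze_step (Ordinal tT) q1 _ _ mq1 _ H1).
    by move=> u; exact: dotp_ge0.
  by move=> w; exact: (proj_step_bound fint fdiff gint gmean fconvex L0 gL mu0
    Fmu xsA xs_min var_perp).
have [psim' zle] : has_mean P (psi t.+1) (z t.+1) /\
    z t.+1 <= z t + eta ^+ 2 * (6 * L * d t + 3 * sA).
  (* At a projection the residual is 0, and only nonnegativity of the right-hand side remains to be
     shown. *)
  have [tI|tI] := boolP (t.+1 \in IT).
    have psi0 := residual_sync (or_intror tI).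
    have zm : has_mean P (psi t.+1) 0.
      by rewrite psi0; exact: has_mean_cst.
    have z0 : z t.+1 = 0 by rewrite /z psi0 expectation_cst.
    rewrite z0; split => //; apply: has_mean_ge0 H2 _ => w.
    apply: addr_ge0; first exact: residual_ge0.
    rewrite mulr_ge0 ?sqr_ge0// addr_ge0//.
      by rewrite mulr_ge0 ?iterate_gap_ge0// mulr_ge0// ltW.
    rewrite mulr_ge0//; apply: (has_mean_ge0 (sA_mean gint var_A)) => w'.
    exact: dotp_ge0.
  have psiE : psi t.+1 = fun w => q2 (step t w (xi t w)).
    by apply/funext => w; rewrite residual_recS (negbTE tI).
  rewrite /z psiE; apply: (@freeze_step (Ordinal tT) q2 _ _ mq2 _ H2).
    by move=> u; exact: dotp_ge0.
  by move=> w; exact: (residual_step_bound fint fdiff gint gmean fconvex L0 gL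
    xsA xs_min var_A gradA).
by split.
Qed.

Lemma run_means t : (t <= T)%N ->
  has_mean P (phi t) (r t) /\ has_mean P (psi t) (z t).
Proof.
elim: t => [_|t ih tT]; last first.
  by have [phim psim] := ih (ltnW tT); have [] := mean_step tT phim psim.
split; first by apply: has_mean_fine; have [] := sqdist0_mean.
apply: has_mean_fine; rewrite residual_sync; last by left.
by have [] := has_mean_cst P 0.
Qed.

Lemma weighted_gap_bound :
  eta * \sum_(j < T) q ^+ (T - j - 1) * d j <=
    q ^+ T * fine (init_dist P A x0 xs)
    + (3 * eta ^+ 2 * sp + 5 * (E%:R - 1) * L * eta ^+ 3 * sA)
      * \sum_(j < T) q ^+ (T - j - 1).
Proof.
have r0E : fine (init_dist P A x0 xs) = r 0.
  by apply: has_mean_inj sqdist0_mean _; have [] := run_means (leq0n T).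
have muL := mu_le_L nontrivial fint fdiff gint gmean L0 gL Fmu.
rewrite r0E; apply: (@weighted_descent _ _ _ _ _ _ _ _ _ _ z) => //.
- apply: (has_mean_ge0 (sA_mean gint var_A)) => w; exact: dotp_ge0.
- by move=> t; apply: fine_ge0; apply: expectation_ge0 => w; exact: sqdist_ge0.
- by move=> t; apply: fine_ge0; apply: expectation_ge0 => w; exact:
  iterate_gap_ge0.
- move=> t tT; have [phim psim] := run_means (ltnW tT).
  by have [] := mean_step tT phim psim.
- move=> t tT; have [phim psim] := run_means (ltnW tT).
  by have [] := mean_step tT phim psim.
- move=> t tT; have [s [st tE sI]] := gap_cover gapE tT.
  by exists s; split=> //; rewrite /z residual_sync// expectation_cst.
Qed.

(** Sum the tangent inequalities at the barycentre u; their linear parts cancel. *)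
Lemma objective_jensen (n : nat) (c : 'I_n -> R) (v : 'I_n -> 'cV[R]_p) :
  (forall i, 0 <= c i) -> 0 < \sum_i c i ->
  F ((\sum_i c i)^-1 *: \sum_i c i *: v i) <= (\sum_i c i)^-1 * \sum_i c i * F
    (v i).
Proof.
move=> c0 C0; rewrite ler_pdivlMl//; set u := _ *: _.
have : \sum_i c i * (F u + dotp (grad F u) (v i - u)) <= \sum_i c i * F (v i).
  by apply: ler_sum => i _; apply: ler_wpM2l => //; exact: Flo.
apply: le_trans; rewrite le_eqVlt; apply/orP; left; apply/eqP.
under [RHS]eq_bigr do rewrite mulrDr dotpDr dotpNr mulrDr.
rewrite !big_split/= -!mulr_suml.
have -> : \sum_i c i * dotp (grad F u) (v i) = dotp (grad F u) (\sum_i c i *: v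
  i).
  rewrite dotpC dotp_suml; apply: eq_bigr => i _.
  by rewrite dotpZl dotpC.
have -> : \sum_i c i *: v i = (\sum_i c i) *: u by rewrite scalerA mulfV
  ?scale1r ?gt_eqF.
by rewrite dotpZr mulrN subrr addr0.
Qed.

(** By linearity the output is the weighted mean of the projected iterates, to which Jensen's
    inequality applies. Dividing the summed bound by eta W leaves the coefficients 1, 3 and 5,
    whence the factor 5. *)
Lemma dpsgd_error_bound :
  (dpsgd_error D P A f IT mu x0 (fun t => xi t : Omega -> Xi) T xs eta <=
   (5 * (Num.min (T%:R^-1) (q ^+ T) * (fine (init_dist P A x0 xs) / eta)
         + eta * sp
         + (E%:R - 1) * L * eta ^+ 2 * sA))%:E)%E.
Proof.
set Delta2 := fine _; have muetale := mu_eta_le.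
have mueta0 : 0 <= mu * eta by rewrite mulr_ge0// ltW.
have q01 : 0 < q <= 1 by rewrite /q; lra.
have [W0 Wmin] := weight_sum_bounds q01 T1.
set W := \sum_(j < T) q ^+ (T - j - 1) in W0 Wmin.
pose yhat w := W^-1 *: \sum_(j < T) q ^+ (T - j - 1) *: y j w.
have outE w : dpsgd_output A f IT mu eta (x0 w) (fun t => xi t w) T = yhat w.
  rewrite /dpsgd_output orth_proj_feasible -scalemxAr mulmx_sumr.
  by congr (_ *: _); apply: eq_bigr => j _; rewrite -scalemxAr.
have yhatA w : feasible A (yhat w).
  by rewrite -outE /dpsgd_output orth_proj_feasible; exact: proj_feasible.
have w0 j : 0 <= q ^+ j by rewrite exprn_ge0// ltW//; case/andP: q01.
have km : has_mean P (fun w => W^-1 * \sum_(j < T) q ^+ (T - j - 1) * dd j w)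
    (W^-1 * \sum_(j < T) q ^+ (T - j - 1) * d j).
  apply: has_meanZ; apply: has_mean_sum => j; apply: has_meanZ.
  by apply: iterate_gap_mean; have [] := run_means (ltnW (ltn_ord j)).
rewrite /dpsgd_error unlock.
apply: le_trans (integral_le_mean _ _ km _) _.
- under eq_fun do rewrite outE.
  apply: measurable_funB => //; apply: measurable_objective.
  apply: measurable_vecZ; apply: measurable_vec_sum => j.
  by apply: measurable_vecZ; exact: measurable_proj_iterate.
- by move=> w; rewrite outE; exact: (gap_ge0 xs_min (yhatA w)).
- move=> w; rewrite outE lerBlDr.
  apply: (le_trans (@objective_jensen T (fun j => q ^+ (T - j - 1))
    (fun j => y j w) (fun j => w0 _) W0)).
  rewrite -/F; have -> : F xs = W^-1 * \sum_(j < T) q ^+ (T - j - 1) * F xs.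
    by rewrite -mulr_suml mulrA mulVf ?mul1r ?gt_eqF.
  rewrite -mulrDr -big_split/=; apply: ler_wpM2l; first by rewrite invr_ge0 ltW.
  by apply: ler_sum => j _; rewrite -mulrDr subrK.
- rewrite lee_fin.
  have D0 : 0 <= Delta2 by apply: has_mean_ge0 sqdist0_mean _; exact:
    sqdist_ge0.
  have sp0 : 0 <= sp.
    by apply: (has_mean_ge0 (sp_mean gint var_perp)) => w; exact: dotp_ge0.
  have sA0 : 0 <= sA.
    by apply: (has_mean_ge0 (sA_mean gint var_A)) => w; exact: dotp_ge0.
  have e0 : 0 <= E%:R - 1 :> R by rewrite subr_ge0 ler1n.
  have := weighted_gap_bound; rewrite -/W -/Delta2.
  move: (\sum_(j < T) _ * d j) => S H.
  have {}H : W^-1 * S <= q ^+ T / W * (Delta2 / eta)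
      + (3 * eta * sp + 5 * (E%:R - 1) * L * eta ^+ 2 * sA).
    rewrite ler_pdivrMl// -(ler_pM2l eta0).
    apply: le_trans H _; rewrite le_eqVlt; apply/orP; left; apply/eqP.
    by field; rewrite !gt_eqF.
  apply: le_trans H _.
  have De0 : 0 <= Delta2 / eta by rewrite divr_ge0// ltW.
  have H1 := ler_wpM2r De0 Wmin.
  have H2 : 0 <= eta * sp by rewrite mulr_ge0// ltW.
  have H3 : 0 <= q ^+ T / W * (Delta2 / eta).
    by rewrite mulr_ge0// divr_ge0// ltW.
  by move: H1 H2 H3; move: (_ * (Delta2 / eta)) (_ * (Delta2 / eta)) => b1 b2;
    lra.
Qed.

End process.

(** Serves the convex rate when the initial distance is 0: that rate is then 0, and with step 0 the
    run stays at its feasible initial point. *)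
Lemma dpsgd_error_zero_step :
  (dpsgd_error D P A f IT mu x0 (fun t => xi t : Omega -> Xi) T xs 0 <=
   (L / 2 * fine (init_dist P A x0 xs))%:E)%E.
Proof.
have xE w t : dpsgd A f IT (fun=> 0) (x0 w) (fun s => xi s w) t = x0 w.
  elim: t => //= t ->; rewrite scale0r subr0 orth_proj_feasible.
  by rewrite (proj_id (x0A w)) if_same.
have outE w : dpsgd_output A f IT mu 0 (x0 w) (fun t => xi t w) T = x0 w.
  rewrite /dpsgd_output.
  rewrite (eq_bigr (fun j : 'I_T => (1 - mu * 0) ^+ (T - j - 1) *: x0 w)); last
    first.
    by move=> j _; rewrite xE.
  rewrite -scaler_suml scalerA mulVf ?scale1r ?orth_proj_feasible ?proj_id//.
  have q01 : 0 < 1 - mu * 0 <= 1 by rewrite mulr0 subr0 ltr01 lexx.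
  by have [/gt_eqF -> _] := weight_sum_bounds q01 T1.
rewrite /dpsgd_error unlock.
apply: integral_le_mean (has_meanZ (L / 2) (sqdist0_mean 0)) _.
- under eq_fun do rewrite outE.
  by apply: measurable_funB => //; exact: measurable_objective.
- by move=> w; rewrite outE; exact: (gap_ge0 xs_min (x0A w)).
- move=> w; rewrite outE /= (proj_id (x0A w)).
  exact: (gap_le fint fdiff gint gmean L0 gL xsA xs_min (x0A w)).
Qed.

End run.

Theorem theorem3p1 (R : realType) :
  exists C c : R, 0 < C /\ 0 < c /\
  forall (p m : nat) (dX dO : measure_display)
    (Xi : measurableType dX) (Omega : measurableType dO)
    (D : probability Xi R) (P : probability Omega R)
    (A : 'M[R]_(p, m)) (f : 'cV[R]_p -> Xi -> R) (L mu : R)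
    (xs : 'cV[R]_p) (T E : nat) (IT : seq nat)
    (x0 : Omega -> 'cV[R]_p) (xi : nat -> {RV P >-> Xi}),
  let F := objective D f in
  (exists2 x, feasible A x & x != 0) ->
  (forall x, D.-integrable setT (EFin \o f x)) ->
  (forall z x, differentiable (f ^~ z) x) ->
  (forall x, differentiable F x) ->
  (forall x i, D.-integrable setT (fun z => (sgrad f x z i 0)%:E)) ->
  (forall x i, 'E_D[(fun z => sgrad f x z i 0)%R]%E = (grad F x i 0)%:E) ->
  (forall z, convex_function [set: 'cV[R]_p] (f ^~ z)) ->
  0 < L ->
  (forall z x y,
     enorm (sgrad f y z - sgrad f x z) <= L * enorm (x - y)) ->
  0 <= mu ->
  (forall x y,
     F y - F x >= dotp (grad F x) (y - x) + mu / 2 * enorm (x - y) ^+ 2) ->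
  feasible A xs ->
  (forall x, feasible A x -> F xs <= F x) ->
  (grad_var D f (feasible A) xs < +oo)%E ->
  (grad_var D f (colspace A) xs < +oo)%E ->
  (forall x, feasible A x -> orth_proj (colspace A) (grad F x) = 0) ->
  (1 <= T)%N ->
  (forall t, t \in IT -> (1 <= t <= T)%N) ->
  gap T IT = E ->
  (1 <= E)%N ->
  (forall i, measurable_fun setT (fun w => x0 w i 0)) ->
  (forall w, feasible A (x0 w)) ->
  (forall t, (t < T)%N -> forall B, measurable B ->
     distribution P (xi t) B = D B) ->
  mutually_independent P
    (source_sigma (T := T) x0 (fun t => xi t : Omega -> Xi)) ->
  (init_dist P A x0 xs < +oo)%E ->
  let Delta := Num.sqrt (fine (init_dist P A x0 xs)) in
  let sigma_perp := Num.sqrt (fine (grad_var D f (feasible A) xs)) in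
  let sigma_A := Num.sqrt (fine (grad_var D f (colspace A) xs)) in
  let err :=
    dpsgd_error D P A f IT mu x0 (fun t => xi t : Omega -> Xi) T xs in
  let e := E%:R - 1 in
  [/\ forall eta : R, 0 < eta -> small_step L mu E eta ->
        (err eta <=
          (C * (Num.min (T%:R^-1) ((1 - mu * eta) ^+ T) * (Delta ^+ 2 / eta)
                + eta * sigma_perp ^+ 2
                + e * L * eta ^+ 2 * sigma_A ^+ 2))%:E)%E,
      mu = 0 ->
        exists eta : R,
        [/\ 0 <= eta, 0 < Delta -> 0 < eta, small_step L mu E eta &
        (err eta <=
          (C * (L * E%:R * Delta ^+ 2 / T%:R
                + Delta / Num.sqrt T%:R * sigma_perp
                + (e * L * Delta ^+ 4) `^ (1 / 3) / T%:R `^ (2 / 3)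
                  * sigma_A `^ (2 / 3)))%:E)%E] &
      0 < mu ->
        let kappa := L / mu in
        exists eta : R,
        [/\ 0 < eta, small_step L mu E eta &
        (err eta <=
          (C * (L * E%:R * Delta ^+ 2 * expR (- (c * (T%:R / (kappa * E%:R))))
                + log_factor ((mu * T%:R * Delta) ^+ 2 / sigma_perp ^+ 2)
                  * (sigma_perp ^+ 2 / (mu * T%:R))
                + log_factor ((mu * T%:R) ^+ 3 * Delta ^+ 2
                              / (e * L * sigma_A ^+ 2)) ^+ 2
                  * (e * L * sigma_A ^+ 2 / (mu ^+ 2 * T%:R ^+ 2))))%:E)%E]].
Proof.
(* 50 is the factor 5 of the error bound times the factor 10 lost in choosing the step; 1/10 comes
   from the stability step 1 / (10 L E). *)
exists 50, (1 / 10); split; first by []; split; first by lra.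
move=> p m dX dO Xi Omega D P A f L mu xs T E IT x0 xi F nontrivial fint fdiff _
  gint gmean fconvex L0 gL mu0 Fmu xsA xs_min var_perp var_A gradA T1 _ gapE E1
  mx0 x0A xiD indep dist0 Delta sigma_perp sigma_A err e.
have bound := dpsgd_error_bound nontrivial fint fdiff gint gmean fconvex L0 gL
  mu0 Fmu xsA xs_min var_perp var_A gradA T1 gapE E1 mx0 x0A xiD indep dist0.
have muL := mu_le_L nontrivial fint fdiff gint gmean L0 gL Fmu.
have fine_expect_ge0 d (W : measurableType d) (Pr : probability W R) (u : W ->
  'cV[R]_p) :
    0 <= fine 'E_Pr[fun w => enorm (u w) ^+ 2].
  by apply/fine_ge0/expectation_ge0 => w; exact: sqr_ge0.
have DeltaE : Delta ^+ 2 = fine (init_dist P A x0 xs).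
  exact/sqr_sqrtr/fine_expect_ge0.
have spE : sigma_perp ^+ 2 = fine (grad_var D f (feasible A) xs).
  exact/sqr_sqrtr/fine_expect_ge0.
have sAE : sigma_A ^+ 2 = fine (grad_var D f (colspace A) xs).
  exact/sqr_sqrtr/fine_expect_ge0.
have D0 : 0 <= Delta by exact: sqrtr_ge0.
have sp0 : 0 <= sigma_perp by exact: sqrtr_ge0.
have sA0 : 0 <= sigma_A by exact: sqrtr_ge0.
have e0 : 0 <= e by rewrite subr_ge0 ler1n.
have t0 : 0 < T%:R :> R by rewrite ltr0n.
rewrite -DeltaE -spE -sAE in bound.
(* M selects which entry of the minimum is kept: the whole minimum for the general bound, 1/T for
   the convex rate, the power for the strongly convex one. *)
have weaken (M : R -> R) (eta B : R) : 0 < eta -> small_step L mu E eta ->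
    Num.min (T%:R^-1) ((1 - mu * eta) ^+ T) <= M eta ->
    M eta * (Delta ^+ 2 / eta) + eta * sigma_perp ^+ 2
      + e * L * eta ^+ 2 * sigma_A ^+ 2 <= 10 * B ->
    (err eta <= (50 * B)%:E)%E.
  move=> eta0 small minM MB; apply: le_trans (bound _ eta0 small) _.
  rewrite lee_fin; have De0 : 0 <= Delta ^+ 2 / eta.
    by rewrite divr_ge0 ?sqr_ge0// ltW.
  by have := ler_wpM2r De0 minM; rewrite -/e; lra.
split.
- move=> eta eta0 small.
  pose B := Num.min T%:R^-1 ((1 - mu * eta) ^+ T) * (Delta ^+ 2 / eta)
    + eta * sigma_perp ^+ 2 + e * L * eta ^+ 2 * sigma_A ^+ 2.
  apply: (weaken (fun eta => Num.min T%:R^-1 ((1 - mu * eta) ^+ T))) => //.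
  have q0 : 0 <= 1 - mu * eta.
    by case: small => _; have := mulr_ge0 (mulr_ge0 e0 (ltW L0)) (ltW eta0);
      rewrite /e; lra.
  suff : 0 <= B by rewrite /B; lra.
  rewrite !addr_ge0 ?mulr_ge0 ?sqr_ge0 ?invr_ge0 ?(ltW eta0) ?(ltW L0)//.
  by rewrite le_min invr_ge0 (ltW t0) exprn_ge0.
- move=> mu_eq0; have [D00|DN] := eqVneq Delta 0.
    exists 0; split => //; first by rewrite D00 ltxx.
      by split; rewrite mulr0.
    have := dpsgd_error_zero_step IT xi fint fdiff gint gmean L0 gL
      mu0 Fmu xsA xs_min T1 mx0 x0A dist0.
    rewrite -/err -DeltaE D00 => /le_trans; apply; rewrite lee_fin.
    rewrite !expr0n/= !mulr0 !mul0r !add0r pmulr_rge0//.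
    by apply: mulr_ge0; [apply: divr_ge0|]; exact: powR_ge0.
  have Dgt0 : 0 < Delta by rewrite lt_def DN.
  have [eta [eta0 small opt]] := convex_step_size L0 Dgt0 sp0 sA0 T1 E1.
  exists eta; rewrite -mu_eq0 in small; split => //; first exact: ltW.
  apply: (weaken (fun=> T%:R^-1)) => //.
  by rewrite ge_min lexx.
- move=> mu_gt0 kappa.
  have [eta [eta0 small opt]] := @strongly_convex_step_size _ T E L mu Delta _ _
    mu_gt0 muL sp0 sA0 T1 E1.
  exists eta; split => //.
  apply: (weaken (fun eta => (1 - mu * eta) ^+ T)) => //.
  by rewrite ge_min lexx orbT.
Qed.
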